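(* Let $\Omega\subseteq\mathbb R^d$ be a bounded convex open set, fix $\zeta\in(0,1]$, and let $\mu_0,\mu_1\in\mathcal P(\overline\Omega)$. Let $\{\mathcal T\}$ be a family of $\zeta$-regular meshes of $\Omega$ satisfying the asymptotic isotropy condition with weight functions $(\lambda^{\mathcal T}_{KL})_{K,L\in\mathcal T}$, and let $(\theta^{\mathcal T}_{KL})_{K,L\in\mathcal T}$ be mean functions on $\mathcal T$ (consisting of admissible means) that are compatible with $(\lambda^{\mathcal T}_{KL})_{K,L\in\mathcal T}$. Then $$\mathbb W_2(\mu_0,\mu_1)\le\liminf_{[\mathcal T]\to0}\mathcal W_{\mathcal T}(P_{\mathcal T}\mu_0,P_{\mathcal T}\mu_1),$$ where $\mathcal W_{\mathcal T}$ is defined using the mean functions $(\theta^{\mathcal T}_{KL})$.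
   Context: $\mathcal P(\overline\Omega)$ is the set of Borel probability measures on $\overline\Omega$, and $\mathbb W_2$ is the $2$-Kantorovich (Wasserstein) metric on it, with respect to the Euclidean distance. Meshes. A mesh of $\Omega$ is a pair $(\mathcal T,\{x_K\}_{K\in\mathcal T})$, where $\mathcal T$ is a finite partition of $\overline\Omega$ into sets (cells) with nonempty and convex interior, and $\{x_K\}_{K\in\mathcal T}\subseteq\overline\Omega$ are distinct points with $x_K\in\overline K$. $|K|$ is the Lebesgue measure of $K$; $(K|L)=\overline K\cap\overline L$ and $|(K|L)|$ is its $(d-1)$-dimensional Hausdorff measure; cells $K\ne L$ are nearest neighbours, $K\sim L$, if $|(K|L)|>0$; $d_{KL}=|x_K-x_L|$; $[\mathcal T]=\max_{K}\operatorname{diam}(K)$. The mesh is admissible if $x_K-x_L\perp(K|L)$ whenever $K\sim L$. An admissible mesh is $\zeta$-regular ($\zeta\in(0,1]$) if $B(x_K,\zeta[\mathcal T])\subseteq K$ for all $K\in\mathcal T$ and $|(K|L)|\ge\zeta[\mathcal T]^{d-1}$ for all $K\sim L$. Means and weights. An admissible mean is a continuous function $\theta:\mathbb R_+\times\mathbb R_+\to\mathbb R_+$ (with $\mathbb R_+=[0,\infty)$) that is $C^\infty$ on $(0,\infty)^2$, positively $1$-homogeneous, jointly concave, and satisfies $\theta(1,1)=1$. A mean function on $\mathcal T$ is a family $(\theta_{KL})_{K,L\in\mathcal T}$ of admissible means with $\theta_{KL}(a,b)=\theta_{LK}(b,a)$. A weight function on $\mathcal T$ is a family $(\lambda_{KL})_{K,L\in\mathcal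 T}\subseteq[0,1]$ with $\lambda_{KL}+\lambda_{LK}=1$ for all $K,L$. A mean function is compatible with a weight function if $\partial_1\theta_{KL}(1,1)=\lambda_{KL}$ for all $K,L$ (equivalently $\theta_{KL}(a,b)\le\lambda_{KL}a+\lambda_{LK}b$ for all $a,b\ge0$). Asymptotic isotropy. A family of admissible meshes $\{\mathcal T\}$ satisfies the asymptotic isotropy condition with weight functions $\{\boldsymbol\lambda^{\mathcal T}\}$ if for all $K\in\mathcal T$ $$\sum_{L\sim K}\lambda^{\mathcal T}_{KL}\frac{|(K|L)|}{d_{KL}}(x_K-x_L)\otimes(x_K-x_L)\le|K|\big(1+\eta_{\mathcal T}(K)\big)I_d$$ in the sense of symmetric matrices, where $\sup_{K\in\mathcal T}|\eta_{\mathcal T}(K)|\to0$ as $[\mathcal T]\to0$. Discrete transport metric. $\mathcal P(\mathcal T)$ is the set of probability measures on the finite set $\mathcal T$. For $m\in\mathcal P(\mathcal T)$ and $\psi,\sigma:\mathcal T\to\mathbb R$, $$\mathcal A_{\mathcal T}(m,\psi)=\tfrac12\sum_{K\sim L}\tfrac{|(K|L)|}{d_{KL}}\,\theta_{KL}\Big(\tfrac{m(K)}{|K|},\tfrac{m(L)}{|L|}\Big)(\psi(K)-\psi(L))^2,\qquad \mathcal A^*_{\mathcal T}(m,\sigma)=\sup_{\psi:\mathcal T\to\mathbb R}\Big\{2\sum_K\psi(K)\sigma(K)-\mathcal A_{\mathcal T}(m,\psi)\Big\}$$ (sum over ordered pairs), and $\mathcal W_{\mathcal T}(m_0,m_1)=\inf\big(\int_0^1\mathcal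 A^*_{\mathcal T}(m_t,\dot m_t)\,dt\big)^{1/2}$, the infimum over all curves $(m_t)_{t\in[0,1]}$ in $\mathcal P(\mathcal T)$ from $m_0$ to $m_1$ such that $t\mapsto m_t(K)$ is absolutely continuous for each $K$. $P_{\mathcal T}:\mathcal P(\overline\Omega)\to\mathcal P(\mathcal T)$ is given by $(P_{\mathcal T}\mu)(K)=\mu(K)$. Limits as $[\mathcal T]\to0$ are taken along the family (which is assumed to contain meshes of arbitrarily small size): $\liminf_{[\mathcal T]\to0}F(\mathcal T)=\sup_{h>0}\inf_{[\mathcal T]\le h}F(\mathcal T)$. *)

(* Defs.v *)
From HB Require Import structures.
From mathcomp Require Import all_boot all_order all_algebra.
From mathcomp Require Import all_classical all_reals all_analysis.

Set Implicit Arguments.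
Unset Strict Implicit.
Unset Printing Implicit Defensive.

Import Order.TTheory GRing.Theory Num.Theory.
Import numFieldNormedType.Exports.

Local Open Scope classical_set_scope.
Local Open Scope ring_scope.

(** The points of R^d are the row vectors ['rV[R]_d]. The norm and the balls that
the library puts on this type are those of the sup norm: only the induced
topology and boundedness are used from it, and all metric quantities below use
the Euclidean norm [enorm]. *)

Definition edot (R : realType) (d : nat) (x y : 'rV[R]_d) : R :=
  \sum_(i < d) x 0 i * y 0 i.

Definition enorm (R : realType) (d : nat) (x : 'rV[R]_d) : R :=
  Num.sqrt (edot x x).

Definition eball (R : realType) (d : nat) (x : 'rV[R]_d) (r : R) :
  set 'rV[R]_d := [set y | enorm (y - x) < r].

(** The real supremum is meaningful on nonempty bounded sets; [diam] is only
used on bounded sets, and [diam set0 = 0]. *)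
Definition diam (R : realType) (d : nat) (A : set 'rV[R]_d) : R :=
  sup [set enorm (x - y) | x in A & y in A].

Definition loewner_le (R : realType) (d : nat) (A B : 'M[R]_d) : Prop :=
  forall v : 'cV[R]_d, (v^T *m A *m v) 0 0 <= (v^T *m B *m v) 0 0.

Definition borel (R : realType) (d : nat) :=
  g_sigma_algebraType (@open 'rV[R]_d).

(** d-dimensional Lebesgue (outer) measure, by countable coverings with closed
boxes. Not meant for d = 0, where every box has volume 1. *)
Definition box (R : realType) (d : nat) (a b : 'rV[R]_d) : set 'rV[R]_d :=
  [set x | forall i, a 0 i <= x 0 i <= b 0 i].

Definition lebesgue (R : realType) (d : nat) (A : set 'rV[R]_d) : \bar R :=
  ereal_inf [set (\sum_(0 <= k <oo)
                   (\prod_(i < d) (ab.2 k 0 i - ab.1 k 0 i))%:E)%E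
    | ab in [set ab : (nat -> 'rV[R]_d) * (nat -> 'rV[R]_d) |
               (forall k i, ab.1 k 0 i <= ab.2 k 0 i) /\
               A `<=` \bigcup_k box (ab.1 k) (ab.2 k)]].

(** Volume of the Euclidean unit ball of R^n,
by [omega_(n+2) = 2 pi / (n+2) omega_n]. *)
Fixpoint unit_ball_volume (R : realType) (n : nat) : R :=
  match n with
  | 0 => 1
  | 1 => 2
  | m.+2 => 2 * pi / m.+2%:R * unit_ball_volume R m
  end.

(** n-dimensional Hausdorff (outer) measure, normalised so as to agree with
Lebesgue measure on n-dimensional planes. The empty set has size 0 and a
nonempty set of diameter 0 has size [0 ^+ n], so that the 0-dimensional measure
is the counting measure. *)
Definition hausdorff_size (R : realType) (d n : nat) (C : set 'rV[R]_d) : R :=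
  if `[< C !=set0 >] then unit_ball_volume R n * (diam C / 2) ^+ n else 0.

Definition hausdorff_pre (R : realType) (d n : nat) (delta : R)
    (A : set 'rV[R]_d) : \bar R :=
  ereal_inf [set (\sum_(0 <= k <oo) (hausdorff_size n (C k))%:E)%E
    | C in [set C : nat -> set 'rV[R]_d |
              (forall k x y, C k x -> C k y -> enorm (x - y) <= delta) /\
              A `<=` \bigcup_k C k]].

Definition hausdorff (R : realType) (d n : nat) (A : set 'rV[R]_d) : \bar R :=
  ereal_sup [set hausdorff_pre n delta A | delta in [set delta | 0 < delta]].

Definition is_coupling (R : realType) (d : nat)
    (mu0 mu1 : probability (borel R d) R)
    (gamma : probability (borel R d * borel R d)%type R) : Prop :=
  forall A : set (borel R d), measurable A ->
    gamma (A `*` setT) = mu0 A /\ gamma (setT `*` A) = mu1 A.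

Definition W2 (R : realType) (d : nat) (mu0 mu1 : probability (borel R d) R) :
    \bar R :=
  poweR (ereal_inf [set (\int[gamma]_(z in setT)
                           ((enorm (z.1 - z.2 : 'rV[R]_d)) ^+ 2)%:E)%E
          | gamma in [set gamma | is_coupling mu0 mu1 gamma]]) 2^-1.

(** The cells are indexed by a finite type; being pairwise disjoint with
nonempty interiors, distinct indices give distinct cells. Cells are Borel sets,
as needed for [P_T mu (K) = mu K]. *)
Record mesh (R : realType) (d : nat) (Omega : set 'rV[R]_d) := Mesh {
  mesh_index : finType;
  cell : mesh_index -> set 'rV[R]_d;
  pt : mesh_index -> 'rV[R]_d;
  cell_measurable :
    forall K, measurable (cell K : set (borel R d));
  cell_disjoint : trivIset setT cell;
  cell_cover : \bigcup_K cell K = closure Omega;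
  cell_interior_nonempty : forall K, interior (cell K) !=set0;
  cell_interior_convex : forall K,
    convex_set (interior (cell K) : set (convex_lmodType 'rV[R]_d));
  pt_in_domain : forall K, closure Omega (pt K);
  pt_inj : injective pt;
  pt_in_cell : forall K, closure (cell K) (pt K)
}.

Arguments cell {R d Omega} T K : rename.
Arguments pt {R d Omega} T K : rename.
Coercion mesh_index : mesh >-> finType.

Section Mesh.
Context (R : realType) (d : nat) (Omega : set 'rV[R]_d) (T : mesh Omega).
Implicit Types K L : T.

(** |K| is always finite, the domain being bounded. |(K|L)| may be infinite for
cells with wild boundaries: such a face counts for [nbr] and [zeta_regular],
which use the extended real [face_measure], and it has weight 0 in the sums that
use [face_area]. *)
Definition cell_vol K : R := fine (lebesgue (cell T K)).

Definition face K L : set 'rV[R]_d := closure (cell T K) `&` closure (cell T L).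

Definition face_measure K L : \bar R := hausdorff d.-1 (face K L).

Definition face_area K L : R := fine (face_measure K L).

Definition nbr K L : bool := (K != L) && (0 < face_measure K L)%E.

Definition pt_dist K L : R := enorm (pt T K - pt T L).

Definition mesh_size : R := \big[Num.max/0]_(K : T) diam (cell T K).

Definition admissible_mesh : Prop :=
  forall K L, nbr K L -> forall p q, face K L p -> face K L q ->
    edot (pt T K - pt T L) (p - q) = 0.

Definition zeta_regular (zeta : R) : Prop :=
  [/\ admissible_mesh,
      forall K, eball (pt T K) (zeta * mesh_size) `<=` cell T K &
      forall K L, nbr K L ->
        ((zeta * mesh_size ^+ d.-1)%:E <= face_measure K L)%E].

End Mesh.

(** [Ck_pos k f]: the function f of two variables is C^k on the open quadrant
(0,oo)^2. *)
Fixpoint Ck_pos (R : realType) (k : nat) (f : R -> R -> R) : Prop :=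
  (forall a b, 0 < a -> 0 < b ->
     {for (a, b), continuous (fun p : R * R => f p.1 p.2)}) /\
  match k with
  | 0 => True
  | k'.+1 =>
      [/\ forall a b, 0 < a -> 0 < b ->
            derivable (fun s => f s b) a 1 /\ derivable (f a) b 1,
          Ck_pos k' (fun a b => derive1 (fun s => f s b) a) &
          Ck_pos k' (fun a b => derive1 (f a) b)]
  end.

(** Only the values of [theta] on [0,oo)^2 matter. *)
Definition admissible_mean (R : realType) (theta : R -> R -> R) : Prop :=
  (forall a b, 0 <= a -> 0 <= b -> 0 <= theta a b) /\
  {within [set p : R * R | 0 <= p.1 /\ 0 <= p.2],
     continuous (fun p : R * R => theta p.1 p.2)} /\
  (forall k, Ck_pos k theta) /\
  (forall r a b, 0 < r -> 0 <= a -> 0 <= b ->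
     theta (r * a) (r * b) = r * theta a b) /\
  (forall t a b a' b', 0 <= t <= 1 ->
     0 <= a -> 0 <= b -> 0 <= a' -> 0 <= b' ->
     t * theta a b + (1 - t) * theta a' b' <=
     theta (t * a + (1 - t) * a') (t * b + (1 - t) * b')) /\
  theta 1 1 = 1.

Definition mean_function (R : realType) (T : finType)
    (theta : T -> T -> R -> R -> R) : Prop :=
  (forall K L, admissible_mean (theta K L)) /\
  (forall K L a b, 0 <= a -> 0 <= b -> theta K L a b = theta L K b a).

Definition weight_function (R : realType) (T : finType)
    (lambda : T -> T -> R) : Prop :=
  (forall K L, 0 <= lambda K L <= 1) /\
  (forall K L, lambda K L + lambda L K = 1).

Definition compatible (R : realType) (T : finType)
    (theta : T -> T -> R -> R -> R) (lambda : T -> T -> R) : Prop :=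
  forall K L, derive1 (fun a => theta K L a 1) 1 = lambda K L.

Definition isotropy_mx (R : realType) (d : nat) (Omega : set 'rV[R]_d)
    (T : mesh Omega) (lambda : T -> T -> R) (K : T) : 'M[R]_d :=
  \sum_(L : T | nbr L K) (lambda K L * (face_area K L / pt_dist K L)) *:
    ((pt T K - pt T L)^T *m (pt T K - pt T L)).

Definition asymptotically_isotropic (R : realType) (d : nat)
    (Omega : set 'rV[R]_d) (I : Type) (T : I -> mesh Omega)
    (lambda : forall i, T i -> T i -> R) : Prop :=
  exists eta : forall i, T i -> R,
    (forall i K, loewner_le (isotropy_mx (lambda i) K)
                            ((cell_vol K * (1 + eta i K))%:M)) /\
    (forall eps : R, 0 < eps -> exists2 h : R, 0 < h &
       forall i, mesh_size (T i) <= h ->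
         \big[Num.max/0]_(K : T i) `|eta i K| <= eps).

Arguments asymptotically_isotropic {R d Omega I} T lambda.

Definition discrete_probability (R : realType) (T : finType) (m : T -> R) :
    Prop :=
  (forall K, 0 <= m K) /\ \sum_(K : T) m K = 1.

Definition abs_continuous01 (R : realType) (f : R -> R) : Prop :=
  forall eps : R, 0 < eps -> exists2 delta : R, 0 < delta &
    forall (n : nat) (a b : 'I_n -> R),
      (forall k, [/\ 0 <= a k, a k <= b k & b k <= 1]) ->
      trivIset setT (fun k => `]a k, b k[%classic) ->
      \sum_(k < n) (b k - a k) < delta ->
      \sum_(k < n) `|f (b k) - f (a k)| < eps.

Section DiscreteTransport.
Context (R : realType) (d : nat) (Omega : set 'rV[R]_d) (T : mesh Omega).
Variable theta : T -> T -> R -> R -> R.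
Implicit Types m psi sigma : T -> R.

Definition action m psi : R :=
  2^-1 * \sum_(K : T) \sum_(L : T | nbr K L)
    face_area K L / pt_dist K L *
    theta K L (m K / cell_vol K) (m L / cell_vol L) * (psi K - psi L) ^+ 2.

Definition action_dual m sigma : \bar R :=
  ereal_sup [set (2 * \sum_(K : T) psi K * sigma K - action m psi)%:E
            | psi in setT].

Definition admissible_curve m0 m1 (m : R -> T -> R) : Prop :=
  [/\ forall t, 0 <= t <= 1 -> discrete_probability (m t),
      forall K, abs_continuous01 (fun t => m t K),
      forall K, m 0 K = m0 K &
      forall K, m 1 K = m1 K].

(** The derivative of an absolutely continuous curve exists almost everywhere
in [0,1]; the total operator [derive1] takes an irrelevant value elsewhere. *)
Definition curve_energy (m : R -> T -> R) : \bar R :=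
  (\int[lebesgue_measure]_(t in `[0%R, 1%R])
     action_dual (m t) (fun K => derive1 (fun s => m s K) t))%E.

Definition discrete_W m0 m1 : \bar R :=
  ereal_inf [set poweR (curve_energy m) 2^-1
            | m in [set m | admissible_curve m0 m1 m]].

End DiscreteTransport.

Definition discretize (R : realType) (d : nat) (Omega : set 'rV[R]_d)
    (T : mesh Omega) (mu : probability (borel R d) R) : T -> R :=
  fun K => fine (mu (cell T K)).

Arguments discretize {R d Omega} T mu.

Definition mesh_liminf (R : realType) (d : nat) (Omega : set 'rV[R]_d)
    (I : Type) (T : I -> mesh Omega) (F : I -> \bar R) : \bar R :=
  ereal_sup [set ereal_inf [set F i | i in [set i | mesh_size (T i) <= h]]
            | h in [set h | 0 < h]].

(* Main.v *)
From HB Require Import structures.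
Require Import Defs.
From mathcomp Require Import all_boot all_order all_algebra.
From mathcomp Require Import all_classical all_reals all_analysis.
From mathcomp Require Import measurable_realfun.
From mathcomp Require Import lra ring.

Set Implicit Arguments.
Unset Strict Implicit.
Unset Printing Implicit Defensive.

Import Order.TTheory GRing.Theory Num.Theory.
Import numFieldNormedType.Exports.

Local Open Scope classical_set_scope.
Local Open Scope ring_scope.

(** By Kantorovich duality, [W2 ^ 2 / 2] is the supremum of
[\int u_1 d mu1 - \int u_0 d mu0] over subsolutions of the Hamilton-Jacobi
equation [d_t u + |grad u|^2 / 2 <= 0]. Finite linear programming duality on a
fixed coarse mesh with points [y_k] suffices: if [phi, psi] are dual potentials,
the soft minimum with temperature [e] of the functions
[|x - y_k|^2 / (2 (s + t)) + phi_k / (1 + s)] is an explicit smooth subsolution,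
which is at most [phi_k / (1 + s)] at [(0, y_k)] and almost at least
[psi_k / (1 + s)] at [(1, y_k)]. For a fine mesh [T] and a curve [m_t], the
definition of [A*] gives
[d/dt sum_K m_t(K) u_t(x_K) <= A*(m_t, m_t') / 2 + A(m_t, u_t) / 2
  + sum_K m_t(K) d_t u_t(x_K)];
since [theta_KL (a, b) <= lambda_KL a + lambda_LK b], the isotropy condition bounds
[A(m_t, u_t)] by [sum_K m_t(K) |grad u_t(x_K)|^2] up to a vanishing error, so the
last two terms add up to at most a vanishing error. Integrating in time requires the fundamental
theorem of calculus for absolutely continuous functions, obtained from the total
variation, the Lebesgue-Stieltjes measure and the Radon-Nikodym theorem. *)

(** * Absolutely continuous functions on the unit interval *)

(** Isotropy controls the action only through quadratic forms in [x_K - x_L], so the test potential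
    needs a first-order expansion whose quadratic remainder is uniform over all cells and times. A
    minimum of paraboloids has kinks and no such expansion. The soft minimum has one, with a
    constant that blows up as the temperature [e] or the time shift [s] tends to 0, and it costs
    [e * ln N] for [N] paraboloids. This is why the potential comes from a coarse mesh that stays
    fixed: [s] is chosen from the tolerance, then the coarse mesh, then [e] from its number of
    cells, and only then how fine [T] must be, so large constants do no harm. Dividing the
    potentials by [1 + s] is forced by the shift: the kernel at time 1 is
    [|x - y|^2 / (2 * (1 + s))], so the dual constraint scales by exactly this factor. The other
    obstacle is the energy: nothing is assumed on the measurability of [t |-> A*(m_t, m_t')], so it
    is only bounded below, almost everywhere, by an integrable function. *)

Section AbsoluteContinuity.
Context {R : realType}.
Implicit Types (f W : R -> R) (s : seq (R * R)) (I J : R * R).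

Definition itv_sep I J : bool := (I.2 <= J.1) || (J.2 <= I.1).

(** Families are lists, unlike in [abs_continuous01], so that an interval can be replaced by a
    subdivision through concatenation. Neighbouring intervals may share an endpoint, and intervals
    may be degenerate. *)
Definition itv_fam s : bool :=
  all (fun I => [&& 0 <= I.1, I.1 <= I.2 & I.2 <= 1]) s && pairwise itv_sep s.

(** Half-open intervals that share only an endpoint are disjoint, which is all that [itv_sep]
    grants. The bound is weakened to [<=] so that it survives suprema over partitions. *)
Lemma abs_continuous_seq f : abs_continuous01 f ->
  forall e, 0 < e -> exists2 delta, 0 < delta & forall s, itv_fam s ->
    \sum_(I <- s) (I.2 - I.1) < delta -> \sum_(I <- s) `|f I.2 - f I.1| <= e.
Proof.
move=> fAC e e0; have [delta d0 H] := fAC e e0.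
exists delta => // s /andP[/allP sin /(pairwiseP (0, 0)) ssep].
rewrite !(big_nth (0, 0)) !big_mkord => slt; apply/ltW.
apply: (H (size s) (fun k => (nth (0, 0) s k).1) (fun k => (nth (0, 0) s k).2)) => //.
- move=> k; have /sin/and3P[] := mem_nth (0, 0) (ltn_ord k); by split.
- suff D (i j : 'I_(size s)) : (i < j)%N ->
      `](nth (0, 0) s i).1, (nth (0, 0) s i).2[%classic `&`
      `](nth (0, 0) s j).1, (nth (0, 0) s j).2[%classic = set0.
    apply/trivIsetP => i j _ _; rewrite neq_ltn => /orP[|]; first exact: D.
    by rewrite setIC; exact: D.
  move=> ij; apply/seteqP; split => // x /= [].
  rewrite !in_itv /= => /andP[xi1 xi2] /andP[xj1 xj2].
  have /orP[h|h] := ssep i j (ltn_ord i) (ltn_ord j) ij.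
    by have := lt_trans xj1 (lt_le_trans xi2 h); rewrite ltxx.
  by have := lt_trans xi1 (lt_le_trans xj2 h); rewrite ltxx.
Qed.

Lemma itv_fam_catCA s1 s2 s3 : itv_fam (s1 ++ s2 ++ s3) = itv_fam (s2 ++ s1 ++ s3).
Proof.
have sC : allrel itv_sep s2 s1 = allrel itv_sep s1 s2.
  by rewrite allrelC; apply: eq_allrel => I J; rewrite /itv_sep orbC.
rewrite /itv_fam !all_cat !pairwise_cat !allrel_catr sC.
do 2 case: (all _ _) => //=; case: (all _ _) => //=.
by case: (allrel _ s1 s2) => //=; do 2 case: (allrel _ _ _) => //=;
  do 2 case: (pairwise _ _) => //=.
Qed.

Lemma sumr_zip_partition (f : R -> R) a p :
  \sum_(I <- zip (a :: p) p) (f I.2 - f I.1) = f (last a p) - f a.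
Proof.
elim: p a => [a|x p IH a] /=; first by rewrite big_nil subrr.
by rewrite big_cons IH /= addrC subrKA.
Qed.

Lemma zip_partition_in a p : path <%R a p ->
  all (fun I => [&& a <= I.1, I.1 <= I.2 & I.2 <= last a p]) (zip (a :: p) p).
Proof.
elim: p a => [//|x p IH a] /= /andP[ax xp].
have H := IH _ xp; rewrite lexx (ltW ax) /=; apply/andP; split.
  have : all (>= x) (x :: p).
    rewrite /= lexx /=; have := xp; rewrite lt_path_sortedE => /andP[h _].
    by apply: sub_all h => y; exact: ltW.
  by move/allP; apply; exact: mem_last.
apply: sub_all H => I /and3P[h -> ->]; by rewrite (le_trans (ltW ax) h).
Qed.

Lemma zip_partition_sep a p : path <%R a p -> pairwise itv_sep (zip (a :: p) p).
Proof.
elim: p a => [//|x p IH a] /= /andP[ax xp]; rewrite IH // andbT.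
apply: sub_all (zip_partition_in xp) => I /and3P[h _ _].
by rewrite /itv_sep /= h.
Qed.

Lemma variation_sum_itvs a b f p : itv_partition a b p ->
  variation a b f p = \sum_(I <- zip (a :: p) p) `|f I.2 - f I.1|.
Proof.
move=> abp; rewrite variation_zip //.
elim: p a {abp} => [a|x p IH a] /=; first by rewrite !big_nil.
by rewrite !big_cons -IH.
Qed.

(** The [delta] of [f] serves its total variation as well: subdividing an interval keeps the total
    length, so the bound on increments holds for all partitions at once. *)
Lemma abs_continuous_TV f : abs_continuous01 f ->
  forall e, 0 < e -> exists2 delta, 0 < delta & forall s, itv_fam s ->
    \sum_(I <- s) (I.2 - I.1) < delta ->
    (\sum_(I <- s) total_variation I.1 I.2 f <= e%:E)%E.
Proof.
move=> fAC e e0; have [delta d0 H] := abs_continuous_seq fAC e0.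
exists delta => // s.
(* The intervals of [s1] already carry their variation, those of [s2] still their increment. Each
   induction step subdivides one interval, pushes the pieces into [s2] and takes the supremum over
   the subdivisions. *)
suff G s1 s2 : itv_fam (s1 ++ s2) -> \sum_(I <- s1 ++ s2) (I.2 - I.1) < delta ->
    (\sum_(I <- s1) total_variation I.1 I.2 f +
     (\sum_(I <- s2) `|f I.2 - f I.1|)%:E <= e%:E)%E.
  move=> fs ss; have := @G s [::]; rewrite cats0 big_nil adde0; exact.
elim: s1 s2 => [s2 fs ss|[a b] s1 IH s2].
  by rewrite big_nil add0e lee_fin; apply: H.
move=> fam sum; rewrite big_cons /=.
have [ab a0 b1] : [/\ a <= b, 0 <= a & b <= 1].
  by move: fam; rewrite /itv_fam /= => /andP[/andP[/and3P[]]].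
have P p : itv_partition a b p -> (\sum_(I <- s1) total_variation I.1 I.2 f +
     (\sum_(I <- zip (a :: p) p ++ s2) `|f I.2 - f I.1|)%:E <= e%:E)%E.
  move=> [pp /eqP lp]; apply: IH.
    rewrite itv_fam_catCA.
    move: fam; rewrite cat_cons; set t := s1 ++ s2; rewrite /itv_fam /= all_cat pairwise_cat.
    move=> /andP[/andP[/and3P[_ _ _] H1] /andP[H2 H3]].
    rewrite H1 H3 zip_partition_sep // !andbT /=; apply/andP; split.
      apply: sub_all (zip_partition_in pp) => I /and3P[h -> h'] /=.
      by rewrite (le_trans a0 h) (le_trans h') // lp.
    apply/allrelP => I J Ip Js; have := allP (zip_partition_in pp) _ Ip.
    move=> /and3P[aI _ Ib]; have := allP H2 _ Js; rewrite /itv_sep /=.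
    move=> /orP[h|h]; apply/orP; [left|right].
      by rewrite (le_trans Ib) // lp.
    by rewrite (le_trans h).
  move: sum; rewrite /= big_cons !big_cat /= (sumr_zip_partition idfun) lp /=.
  by rewrite addrCA.
rewrite -addeA; set S := (_ + (\sum_(I <- s2) _)%:E)%E.
have S0 : (0 <= S)%E.
  apply: adde_ge0; last by rewrite lee_fin sumr_ge0.
  rewrite big_seq; apply: sume_ge0 => I Is; apply: total_variation_ge0.
  by move: fam; rewrite /itv_fam /= all_cat => /andP[/and3P[_ /allP/(_ _ Is)/and3P[]]].
have SP p : itv_partition a b p -> ((variation a b f p)%:E + S <= e%:E)%E.
  move=> pp; rewrite (variation_sum_itvs f pp) /S addeCA -EFinD -big_cat; exact: P.
have [p pp] : exists p, itv_partition a b p.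
  have [<-|nab] := eqVneq a b; first by exists [::].
  by exists [:: b]; apply: itv_partition1; rewrite lt_neqAle nab.
(* The supremum is moved past [S], which has to be finite; the bound for a single partition shows
   this. *)
have Sfin : S \is a fin_num.
  rewrite ge0_fin_numE // (le_lt_trans _ (ltry e)) // (le_trans _ (SP _ pp)) //.
  by rewrite leeDr // lee_fin variation_ge0.
rewrite -leeBrDr // ge_ereal_sup // => _ [_ [q qq <-] <-].
by rewrite leeBrDr //; exact: SP.
Qed.

(** Steps of length [d / 2 < d] have variation at most 1, and finitely many of them cover the unit
    interval. *)
Lemma abs_continuous_TV_lty f : abs_continuous01 f ->
  (total_variation 0 1 f < +oo)%E.
Proof.
move=> fAC; have [d d0 H] := abs_continuous_TV fAC (@ltr01 R).
suff K (k : nat) : (total_variation 0 (Num.min (k%:R * (d / 2)) 1)%R f < +oo)%E.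
  pose k := (Num.bound (2 / d)).
  have := K k; rewrite min_r // -ler_pdivrMr ?divr_gt0 //.
  by rewrite div1r invf_div ltW // archi_boundP // divr_ge0 // ltW.
have h0 : 0 <= d / 2 by rewrite divr_ge0 // ltW.
elim: k => [|k IH].
  by rewrite mul0r min_l // total_variationxx ltry.
set x := Num.min (k%:R * (d / 2)) 1 in IH *; set y := Num.min _ _.
have kk : k%:R * (d / 2) <= k.+1%:R * (d / 2).
  by rewrite ler_wpM2r // ler_nat.
have xy : x <= y by rewrite /x /y le_min !ge_min kk lexx /= orbT.
have x0 : 0 <= x by rewrite /x le_min ler01 mulr_ge0.
have y1 : y <= 1 by rewrite /y ge_min lexx orbT.
rewrite (total_variationD f x0 xy) lte_add_pinfty //.
apply: le_lt_trans (ltry 1); have := H [:: (x, y)].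
rewrite !big_seq1 /=; apply; first by rewrite /itv_fam /= x0 xy y1.
apply: (@le_lt_trans _ _ (d / 2)); last by lra.
rewrite /x /y lerBlDr; case: (leP (k%:R * (d / 2)) 1) => h.
  by rewrite ge_min; apply/orP; left; rewrite -natr1; lra.
by rewrite ge_min; apply/orP; right; lra.
Qed.

Definition ac_mono W := {in `[0, 1] &, nondecreasing_fun W} /\
  forall e, 0 < e -> exists2 delta, 0 < delta & forall s, itv_fam s ->
    \sum_(I <- s) (I.2 - I.1) < delta -> \sum_(I <- s) (W I.2 - W I.1) <= e.

(** Jordan decomposition with [V x] the variation on [[0, x]]: [f = V - (V - f)], and the increments
    of [V - f] are at most twice those of [V]. *)
Lemma abs_continuous_mono f : abs_continuous01 f ->
  exists W1 W2, [/\ ac_mono W1, ac_mono W2 & f = W1 \- W2].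
Proof.
move=> fAC; pose V := fun x => fine (total_variation 0 x f).
have TV01 := abs_continuous_TV_lty fAC.
have Vfin x y : 0 <= x -> x <= y -> y <= 1 -> total_variation x y f \is a fin_num.
  move=> x0 xy y1; rewrite ge0_fin_numE ?total_variation_ge0 //.
  apply: le_lt_trans TV01; rewrite (total_variationD f x0 (le_trans xy y1)).
  rewrite (total_variationD f xy y1) addeCA leeDl // adde_ge0 //;
    exact: total_variation_ge0.
have VB x y : 0 <= x -> x <= y -> y <= 1 ->
    V y - V x = fine (total_variation x y f).
  move=> x0 xy y1; rewrite /V (total_variationD f x0 xy) fineD ?Vfin //; last first.
    exact: le_trans xy y1.
  by rewrite addrC addKr.
have Vf x y : 0 <= x -> x <= y -> y <= 1 -> `|f y - f x| <= V y - V x.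
  move=> x0 xy y1; rewrite VB // -lee_fin fineK ?Vfin //.
  exact: total_variation_ge.
have VAC e : 0 < e -> exists2 delta, 0 < delta & forall s, itv_fam s ->
    \sum_(I <- s) (I.2 - I.1) < delta -> \sum_(I <- s) (V I.2 - V I.1) <= e.
  move=> e0; have [d d0 H] := abs_continuous_TV fAC e0.
  exists d => // s fs ls; have := H s fs ls.
  move: fs => /andP[/allP fs _].
  rewrite (_ : (\sum_(I <- s) _)%E = (\sum_(I <- s) (V I.2 - V I.1))%:E) ?lee_fin //.
  rewrite -sumEFin big_seq [RHS]big_seq; apply: eq_bigr => I /fs /and3P[a b c].
  by rewrite VB // fineK // Vfin.
exists V, (V \- f); split.
- split=> // x y; rewrite !in_itv /= => /andP[x0 x1] /andP[y0 y1] xy.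
  by rewrite -subr_ge0 (le_trans _ (Vf _ _ _ _ _)).
- split.
    move=> x y; rewrite !in_itv /= => /andP[x0 x1] /andP[y0 y1] xy.
    have := Vf _ _ x0 xy y1; move/(le_trans (ler_norm _)); lra.
  move=> e e0; have e20 : 0 < e / 2 by lra.
  have [d d0 H] := VAC _ e20; exists d => // s fs ls.
  have := H s fs ls; move: (fs) => /andP[/allP fs' _] H1.
  suff : \sum_(I <- s) (V I.2 - f I.2 - (V I.1 - f I.1)) <=
    2 * \sum_(I <- s) (V I.2 - V I.1) by move=> h; rewrite /=; lra.
  rewrite mulr_sumr big_seq [leRHS]big_seq; apply: ler_sum => I /fs' /and3P[a b c].
  have := Vf _ _ a b c; move/(le_trans (ler_norm _)) => h.
  by have := Vf _ _ a b c; rewrite distrC; move/(le_trans (ler_norm _)); lra.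
- by apply/funext => x /=; rewrite opprB addrC subrK.
Qed.

Local Notation mu := (@lebesgue_measure R).

Definition clamp01 (x : R) : R := Num.max 0 (Num.min x 1).

Lemma clamp01_itv x : 0 <= clamp01 x <= 1.
Proof. by rewrite /clamp01 le_max lexx /= ge_max ler01 ge_min lexx orbT. Qed.

Lemma clamp01_id x : 0 <= x <= 1 -> clamp01 x = x.
Proof. by move=> /andP[x0 x1]; rewrite /clamp01 min_l // max_r. Qed.

Lemma clamp01_le x y : x <= y -> clamp01 x <= clamp01 y.
Proof.
by move=> xy; rewrite /clamp01 /Num.min /Num.max; do ! case: ifPn; lra.
Qed.

Lemma clamp01_dist x y : x <= y -> clamp01 y - clamp01 x <= y - x.
Proof. by move=> xy; rewrite /clamp01 /Num.min /Num.max; do ! case: ifPn; lra. Qed.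

Section Monotone.
Variable W : R -> R.
Hypothesis W_ac : ac_mono W.

(* The extension of [W] by constants is a cumulative function on the line. *)
Let h := W \o clamp01.

Let h_nd : nondecreasing_fun h.
Proof.
by move=> x y xy; apply: W_ac.1; rewrite ?in_itv /= ?clamp01_itv // clamp01_le.
Qed.

Let h_rc : right_continuous h.
Proof.
apply: right_continuousW => x; apply/cvgrPdist_le => e e0.
have [d d0 H] := W_ac.2 e e0; near=> y.
have : `|x - y| < d by near: y; exact: (@nbhsx_ballx _ R x d d0).
have K u v : u <= v -> `|u - v| < d -> `|h u - h v| <= e.
  move=> uv; rewrite distrC ger0_norm ?subr_ge0 // => uvd.
  rewrite distrC ger0_norm ?subr_ge0 ?h_nd //.
  have := H [:: (clamp01 u, clamp01 v)]; rewrite !big_seq1 /=; apply.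
    have /andP[u0 _] := clamp01_itv u; have /andP[_ v1] := clamp01_itv v.
    by rewrite /itv_fam /= u0 v1 clamp01_le.
  exact: le_lt_trans (clamp01_dist uv) _.
case: (leP x y) => [|/ltW] xy; first exact: K.
by rewrite distrC => ?; rewrite distrC; exact: K.
Unshelve. all: by end_near. Qed.

HB.instance Definition _ := isCumulative.Build R _ R h h_nd h_rc.

Let nu : measure _ _ := lebesgue_stieltjes_measure h.

Let nu_oc a b : a <= b -> nu `]a, b]%classic = (h b - h a)%:E.
Proof.
move=> ab; rewrite /nu /= /lebesgue_stieltjes_measure /measure_extension.
by rewrite measurable_mu_extE/=; [rewrite wlength_itv_bnd|exact: is_ocitv].
Qed.

Let D : set R := `]0, 1]%classic.

Let mD : measurable (D : set (measurableTypeR R)).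
Proof. exact: measurable_itv. Qed.

Let nuD : (nu D < +oo)%E.
Proof. by rewrite /D nu_oc ?ltry. Qed.

Let nu0 : {finite_measure set _ -> \bar R} := mfrestr mD nuD.

Lemma uniq_pairwise (T : eqType) (r : rel T) (s : seq T) : uniq s ->
  {in s &, forall i j, i != j -> r i j} -> pairwise r s.
Proof.
elim: s => [//|x s IH] /= /andP[xs us] H; apply/andP; split.
  apply/allP => y ys; apply: H; rewrite ?inE ?eqxx ?ys ?orbT //.
  by apply: contraNneq xs => ->.
by apply: IH => // i j is_ js; apply: H; rewrite inE ?is_ ?js orbT.
Qed.

(** The endpoints are the infimum and the supremum of the intersection of [U] and [D]. The open
    interval measures length and separation, the half-open one has an increment of [W] as its
    Stieltjes measure. The infimum is not attained since [U] is open and [D] is open on the left,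
    whereas the supremum may be attained at 1. *)
Let itv_end (U : set R) : open U -> is_interval U ->
  exists I : R * R, [/\ 0 <= I.1, I.1 <= I.2 & I.2 <= 1] /\
    [/\ `]I.1, I.2[%classic `<=` U `&` D & U `&` D `<=` `]I.1, I.2]%classic].
Proof.
move=> oU iU; have [UD0|/set0P[z zUD]] := eqVneq (U `&` D) set0.
  exists (0, 0); split => /=; first by rewrite lexx ler01.
  by rewrite UD0 set_itv_ge ?bnd_simp ?ltxx //; split; exact: sub0set.
set S := U `&` D.
have lS : lbound S 0 by move=> x [_]; rewrite /D /= in_itv /= => /andP[/ltW].
have uS : ubound S 1 by move=> x [_]; rewrite /D /= in_itv /= => /andP[].
have S0 : S !=set0 by exists z.
have hi : has_inf S by split => //; exists 0.
have hs : has_sup S by split => //; exists 1.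
have infl x : S x -> inf S <= x by move=> Sx; apply: ge_inf => //; exists 0.
have supu x : S x -> x <= sup S by move=> Sx; apply: ub_le_sup => //; exists 1.
exists (inf S, sup S); split; split => /=.
- exact: lb_le_inf.
- exact: le_trans (infl _ zUD) (supu _ zUD).
- exact: ge_sup.
- move=> x /=; rewrite in_itv /= => /andP[ix xs].
  have [y Sy yx] := inf_adherent (eqbRL (subr_gt0 _ _) ix) hi.
  have [w Sw xw] := sup_adherent (eqbRL (subr_gt0 _ _) xs) hs.
  rewrite addrC subrK in yx; rewrite opprB addrC subrK in xw.
  split; first by apply: (iU y w) => //; [exact: Sy.1|exact: Sw.1|rewrite !ltW].
  have := Sy.2; have := Sw.2; rewrite /D /= !in_itv /= => /andP[_ w1] /andP[y0 _].
  by rewrite (lt_trans y0 yx) (le_trans (ltW xw) w1).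
- move=> x Sx; rewrite /= in_itv /= supu // andbT lt_neqAle infl // andbT.
  apply/eqP => xE; have [Ux Dx] := Sx.
  have x0 : 0 < x by move: Dx; rewrite /D /= in_itv /= => /andP[].
  have /nbhs_ballP[e /= e0 eU] : nbhs x U by apply: open_nbhs_nbhs.
  pose y := x - Num.min e x / 2.
  have m0 : 0 < Num.min e x by rewrite lt_min e0 x0.
  have mx : Num.min e x <= x by rewrite ge_min lexx orbT.
  have me : Num.min e x <= e by rewrite ge_min lexx.
  have /infl : S y.
    split; first by apply: eU; rewrite /ball /= /y opprB addrC subrK gtr0_norm; lra.
    move: Dx; rewrite /D /= !in_itv /= /y => /andP[_ x1]; lra.
  by rewrite xE /y; lra.
Qed.

(** A null set lies in an open set of Lebesgue measure below [d]. The components of this set, cut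
    down to [D], form families of total length below [d], so the increments of [W], and with them
    the Stieltjes masses, sum to at most [e]. *)
Let nu0_dom : nu0 `<< mu.
Proof.
apply/null_content_dominatesP => N mN N0.
apply/eqP; rewrite -measure_le0 /=; apply/lee_addgt0Pr => e e0; rewrite add0e.
have [d d0 Hd] := W_ac.2 e e0.
have [U [oU NU UN]] : exists U : set R, [/\ open U, N `<=` U & (mu (U `\` N) < d%:E)%E].
  by apply: lebesgue_regularity_outer => //; rewrite N0 ltry.
have mU : measurable (U : set (measurableTypeR R)) by exact: open_measurable.
have muU : (mu U < d%:E)%E.
  rewrite (le_lt_trans _ UN) // -[leRHS]add0e -N0.
  rewrite (_ : mu U = mu (N `|` (U `\` N))); last by rewrite setDUK.
  apply: measureU2 => //; exact: measurableD.
pose V := open_disjoint_itv oU.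
have oV i : open (V i) by exact: open_disjoint_itv_open.
have mV i : measurable (V i : set (measurableTypeR R)).
  exact: open_measurable.
have /choice[ab Hab] i := itv_end (oV i) (@open_disjoint_itv_is_interval _ _ oU i).
rewrite /nu0 /= /mfrestr /mrestr.
apply: (@le_trans _ _ (\sum_(0 <= i <oo) nu (V i `&` D))%E).
  apply: measure_sigma_subadditive.
  - by move=> i; exact: measurableI.
  - exact: measurableI.
  - by rewrite -setI_bigcupl -open_disjoint_itv_bigcup; exact: setSI.
apply: lime_le; first by apply: is_cvg_nneseries.
apply: nearW => n.
(* Once degenerate intervals are dropped, separation follows from the disjointness of the
   components: two overlapping proper intervals share the midpoint of their overlap. *)
pose s := [seq ab i | i <- iota 0 n & (ab i).1 < (ab i).2].
have Fsum (f : R -> R) : \sum_(I <- s) (f I.2 - f I.1) =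
    \sum_(0 <= i < n) (f (ab i).2 - f (ab i).1).
  rewrite /s big_map big_filter /index_iota subn0 big_mkcond /=.
  apply: eq_bigr => i _; case: ifPn => //; rewrite -leNgt => ba.
  have [[_ ab' _] _] := Hab i.
  by rewrite (_ : (ab i).2 = (ab i).1) ?subrr //; apply/eqP; rewrite eq_le ba ab'.
have sub i : `](ab i).1, (ab i).2[%classic `<=` V i.
  by have [_ [/subset_trans + _]] := Hab i; apply; exact: subIsetl.
have fs : itv_fam s.
  apply/andP; split.
    by apply/allP => I /mapP[i _ ->]; have [[-> -> ->]] := Hab i.
  rewrite /s pairwise_map; apply: uniq_pairwise; first by rewrite filter_uniq ?iota_uniq.
  move=> i j; rewrite !mem_filter => /andP[iab _] /andP[jab _] ij /=.
  rewrite /itv_sep; case: leP => //= h1; case: leP => //= h2; exfalso.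
  have /trivIsetP := @open_disjoint_itv_trivIset _ _ oU; move=> /(_ i j Logic.I Logic.I ij).
  rewrite -/V => /seteqP[+ _].
  pose a := Num.max (ab i).1 (ab j).1; pose b := Num.min (ab i).2 (ab j).2.
  have [m1 m2] : a < (a + b) / 2 /\ (a + b) / 2 < b.
    have : a < b by rewrite /a /b gt_max !lt_min iab jab h1 h2.
    by split; lra.
  move=> /(_ ((a + b) / 2)); apply; split; apply: sub => /=; rewrite in_itv /=.
    move: m1 m2; rewrite {1}/a {3}/b gt_max lt_min => /andP[-> _] /andP[-> _] //.
  move: m1 m2; rewrite {1}/a {3}/b gt_max lt_min => /andP[_ ->] /andP[_ ->] //.
have ls : \sum_(I <- s) (I.2 - I.1) < d.
  rewrite (Fsum idfun) -lte_fin (le_lt_trans _ muU) //.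
  rewrite -sumEFin big_mkord.
  apply: (@le_trans _ _ (\sum_(i < n) mu (V i))%E).
    apply: lee_sum => i _; have [[h1 h2 h3] _] := Hab i.
    apply: (@le_trans _ _ (mu `](ab i).1, (ab i).2[%classic)).
      rewrite lebesgue_measure_itv /= lte_fin; case: ltP => //= ba.
      by rewrite lee_fin subr_le0.
    by apply: le_measure; rewrite ?inE //; exact: sub.
  rewrite -measure_bigsetU //; last exact: open_disjoint_itv_trivIset.
  apply: le_measure; rewrite ?inE //; first exact: bigsetU_measurable.
  rewrite [X in _ `<=` X](open_disjoint_itv_bigcup oU).
  exact: bigsetU_bigcup.
have := Hd s fs ls; rewrite -lee_fin; apply: le_trans.
rewrite Fsum -sumEFin; apply: lee_sum => i _.
have [[h1 h2 h3] [_ h4]] := Hab i.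
apply: (@le_trans _ _ (nu `](ab i).1, (ab i).2]%classic)).
  by apply: le_measure; rewrite ?inE //; exact: measurableI.
rewrite nu_oc // /h /= !clamp01_id ?h1 ?h3 ?(le_trans h1) ?(le_trans h2) //.
Qed.

(** [g] is the Radon-Nikodym density of the Stieltjes measure of [W]. Its indefinite integral is
    [W - W 0] on the unit interval, so Lebesgue differentiation gives the derivative of [W] almost
    everywhere. *)
Lemma ac_mono_derivable : exists g : R -> R,
  [/\ mu.-integrable setT (EFin \o g),
      {ae mu, forall x, 0 < x < 1 -> derivable W x 1 /\ derive1 W x = g x} &
      (\int[mu]_(x in `]0%R, 1%R]) (g x)%:E = (W 1 - W 0)%:E)%E].
Proof.
have [g' [g0 gfin gint gE]] := radon_nikodym_sigma_finite nu0_dom.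
pose g := fine \o g'.
have gg' : EFin \o g = g' by apply/funext => x /=; rewrite fineK.
have Ig y : 0 <= y <= 1 -> (\int[mu]_(x in `]0%R, y]) (g x)%:E = (W y - W 0)%:E)%E.
  move=> /andP[y0 y1]; rewrite [LHS](_ : _ = \int[mu]_(x in `]0%R, y]) g' x)%E; last first.
    by rewrite -gg'.
  rewrite -gE; last exact: measurable_itv.
  rewrite /nu0 /= /mfrestr /mrestr setIidl; last first.
    move=> x; rewrite /D /= !in_itv /= => /andP[-> /le_trans]; exact.
  by rewrite nu_oc // /h /= !clamp01_id ?lexx ?y0 ?ler01.
have gint' : mu.-integrable setT (EFin \o g) by rewrite gg'.
exists g; split=> //; last by rewrite Ig // ler01 lexx.
have gitv (i : interval R) : mu.-integrable [set` i] (EFin \o g).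
  by apply: (integrableS measurableT) => //; exact: measurable_itv.
have := @FTC1 R g (BRight 0) (fun y => gitv _) (open_integrable_locally openT gint').
apply: filterS; first exact: (ae_filter_ringOfSetsType mu).
move=> x /= H /andP[x0 x1]; have {H} [] := H x0.
set F := fun _ => _ => dF F'.
have FW : \forall y \near x, F y + W 0 = W y.
  near=> y; rewrite /F /Rintegral Ig /=; first by rewrite subrK.
  apply/andP; split; apply/ltW; near: y; [exact: lt_nbhsr|exact: lt_nbhsl].
have FWd : is_derive x 1 W (g x).
  apply: near_eq_is_derive FW _.
  have Fd : is_derive x 1 F (g x) by apply: DeriveDef; rewrite -?derive1E.
  by rewrite -[g x]addr0; apply: is_deriveD.
by split; [|rewrite derive1E derive_val].
Unshelve. all: by end_near. Qed.

End Monotone.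

Lemma abs_continuous_derivable f : abs_continuous01 f -> exists g : R -> R,
  [/\ mu.-integrable setT (EFin \o g),
      {ae mu, forall x, 0 < x < 1 -> derivable f x 1 /\ derive1 f x = g x} &
      (\int[mu]_(x in `]0%R, 1%R]) (g x)%:E = (f 1 - f 0)%:E)%E].
Proof.
move=> /abs_continuous_mono[W1 [W2 [/ac_mono_derivable[g1 [i1 d1 e1]]]]].
move=> /ac_mono_derivable[g2 [i2 d2 e2]] ->.
exists (g1 \- g2); split.
- rewrite (_ : _ \o _ = (EFin \o g1) \- (EFin \o g2))%E //; exact: integrableB.
- apply: filterS2 d1 d2; first exact: (ae_filter_ringOfSetsType mu).
  move=> x H1 H2 x01; have [D1 E1] := H1 x01; have [D2 E2] := H2 x01.
  by split; [exact: derivableB|rewrite derive1E deriveB // -!derive1E E1 E2].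
- under eq_integral do rewrite /= EFinB.
  have mI : measurable (`]0%R, 1%R] : set (measurableTypeR R)) by exact: measurable_itv.
  rewrite integralB //; [|exact: integrableS i1|exact: integrableS i2].
  by rewrite e1 e2 -EFinB /=; congr (_%:E); ring.
Qed.

End AbsoluteContinuity.

(** * Duality for finite transport problems *)

Section TransportDuality.
Context {R : realFieldType}.

Definition linear_form (V : lmodType R) (f : V -> R) :=
  forall k x y, f (k *: x + y) = k * f x + f y.

(* Bartl's induction: if [z] violates the conclusion for the first [n] forms, then
[a n z > 0] and all forms can be made to vanish at [z] by subtracting multiples
of [a n]. *)
Lemma farkas_nat (V : lmodType R) n (a : nat -> V -> R) (b : V -> R) :
  (forall i, linear_form (a i)) -> linear_form b ->
  (forall x, (forall i, (i < n)%N -> a i x <= 0) -> b x <= 0) ->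
  exists l : nat -> R, (forall i, 0 <= l i) /\
    forall x, b x = \sum_(i < n) l i * a i x.
Proof.
elim: n a b => [|n IH] a b la lb ab.
  exists (fun=> 0); split=> // x; rewrite big_ord0.
  have b0 : b 0 = 0 by have := lb 1 0 0; rewrite scale1r addr0; lra.
  have bN y : b (- y) = - b y.
    by have := lb (-1) y 0; rewrite scaleN1r addr0 b0; lra.
  apply/eqP; rewrite eq_le ab //= -oppr_le0 -bN; exact: ab.
have [h|] := pselect (forall x, (forall i, (i < n)%N -> a i x <= 0) -> b x <= 0).
  have [l [l0 bE]] := IH a b la lb h.
  exists (fun i => if i == n then 0 else l i); split; first by move=> i; case: ifP.
  move=> x; rewrite big_ord_recr /= eqxx mul0r addr0 bE; apply: eq_bigr => i _.
  by rewrite ltn_eqF.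
move=> /existsNP[z /not_implyP[az /negP]]; rewrite -ltNge => bz.
have anz : 0 < a n z.
  rewrite ltNge; apply/negP => anz; have : b z <= 0; last by rewrite leNgt bz.
  by apply: ab => i; rewrite ltnS leq_eqVlt => /predU1P[->//|]; exact: az.
pose t := a n z.
pose a' i x := a i x - a i z / t * a n x.
pose b' x := b x - b z / t * a n x.
have [||x a'x|l [l0 bE]] := IH a' b'.
- by move=> i k x y; rewrite /a' !la; ring.
- by move=> k x y; rewrite /b' lb la; ring.
- have pE f : linear_form f -> f (- (a n x / t) *: z + x) = f x - f z / t * a n x.
    by move=> lf; rewrite lf; ring.
  rewrite /b' -pE //; apply: ab => i; rewrite pE // ltnS leq_eqVlt => /predU1P[->|].
    by rewrite divff ?gt_eqF // mul1r subrr.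
  exact: a'x.
exists (fun i => if i == n then b z / t - \sum_(i < n) l i * (a i z / t) else l i).
split=> [i|x].
  case: ifP => // _; rewrite subr_ge0.
  apply: (@le_trans _ _ 0); last by rewrite divr_ge0 // ltW.
  rewrite -oppr_ge0 -sumrN; apply: sumr_ge0 => j _.
  by rewrite -mulrN mulr_ge0 // -mulNr divr_ge0 ?(ltW anz) // oppr_ge0 az.
rewrite big_ord_recr /= eqxx mulrBl mulr_suml addrCA -sumrB.
rewrite -[LHS](subrK (b z / t * a n x)) -/(b' x) bE addrC; congr (_ + _).
by apply: eq_bigr => i _; rewrite ltn_eqF // /a'; ring.
Qed.

Lemma farkas (V : lmodType R) (J : finType) (a : J -> V -> R) (b : V -> R) :
  (forall i, linear_form (a i)) -> linear_form b ->
  (forall x, (forall i, a i x <= 0) -> b x <= 0) ->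
  exists l : J -> R, (forall i, 0 <= l i) /\ forall x, b x = \sum_i l i * a i x.
Proof.
move=> la lb ab.
pose a' i := if insub i is Some j then a (enum_val (j : 'I_#|J|)) else fun=> 0.
have [||x a'x|l [l0 bE]] := @farkas_nat V #|J| a' b.
- by move=> i; rewrite /a'; case: insubP => // _ k x y; rewrite mulr0 addr0.
- by [].
- apply: ab => i; have := a'x (enum_rank i) (ltn_ord _).
  by rewrite /a' valK enum_rankK.
exists (fun i => l (enum_rank i)); split => // x; rewrite bE.
rewrite (reindex (@enum_rank J)) /=; last first.
  by exists (@enum_val J predT) => i _; [exact: enum_rankK|exact: enum_valK].
by apply: eq_bigr => i _; rewrite /a' valK enum_rankK.
Qed.

(** Farkas for the homogenised problem in [(phi, psi, r)], where the scale [r] turns the constraints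
    into [psi L - phi K <= r * c K L]. The multipliers of these constraints form the plan [g], and
    that of [r >= 0] is the slack in the cost bound. *)
Lemma transport_duality (T : finType) (c : T -> T -> R) (m0 m1 : T -> R) (v : R) :
  (forall K, 0 <= m0 K) -> \sum_K m0 K = 1 ->
  (forall K, 0 <= m1 K) -> \sum_K m1 K = 1 ->
  (forall phi psi : T -> R, (forall K L, psi L - phi K <= c K L) ->
    \sum_K psi K * m1 K - \sum_K phi K * m0 K <= v) ->
  exists g : T -> T -> R, [/\ forall K L, 0 <= g K L,
    forall K, \sum_L g K L = m0 K, forall L, \sum_K g K L = m1 L &
    \sum_K \sum_L g K L * c K L <= v].
Proof.
move=> m00 m01 m10 m11 dual.
pose V : lmodType R := ({ffun T -> R^o} * {ffun T -> R^o} * R^o)%type.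
pose a (i : option (T * T)) (x : V) : R :=
  if i is Some (K, L) then x.1.2 L - x.1.1 K - x.2 * c K L else - x.2.
pose b (x : V) : R := \sum_K x.1.2 K * m1 K - \sum_K x.1.1 K * m0 K - x.2 * v.
have la i : linear_form (a i).
  by move=> k x y; rewrite /a; case: i => [[K L]|] /=; rewrite ?ffunE /GRing.scale /=; ring.
have lb : linear_form b.
  move=> k x y; rewrite /b /= !mulrBr !mulr_sumr.
  rewrite (_ : \sum_K _ = \sum_K k * (x.1.2 K * m1 K) + \sum_K y.1.2 K * m1 K); last first.
    by rewrite -big_split; apply: eq_bigr => K _; rewrite !ffunE /GRing.scale /=; ring.
  rewrite (_ : \sum_K _ * m0 K = \sum_K k * (x.1.1 K * m0 K) + \sum_K y.1.1 K * m0 K); last first.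
    by rewrite -big_split; apply: eq_bigr => K _; rewrite !ffunE /GRing.scale /=; ring.
  by rewrite /GRing.scale /=; ring.
have ab x : (forall i, a i x <= 0) -> b x <= 0.
  move=> ax; have r0 : 0 <= x.2 by have := ax None; rewrite /a oppr_le0.
  have aKL K L : x.1.2 L - x.1.1 K <= x.2 * c K L by have := ax (Some (K, L)); rewrite /a subr_le0.
  (* For [r = 0] the constraints say that every value of [psi] is at most every value of [phi], and
     averaging against the product of [m0] and [m1] concludes. For [r > 0], dividing by [r] gives
     feasible potentials. *)
  rewrite /b subr_le0; have [r_eq0|rn0] := eqVneq x.2 0.
    rewrite r_eq0 mul0r subr_le0.
    rewrite (_ : \sum_K x.1.2 K * m1 K = \sum_K \sum_L m0 K * m1 L * x.1.2 L); last first.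
      rewrite exchange_big; apply: eq_bigr => L _.
      by rewrite -!mulr_suml m01 mul1r mulrC.
    rewrite (_ : \sum_K x.1.1 K * m0 K = \sum_K \sum_L m0 K * m1 L * x.1.1 K); last first.
      apply: eq_bigr => K _.
      by rewrite -mulr_suml -mulr_sumr m11 mulr1 mulrC.
    apply: ler_sum => K _; apply: ler_sum => L _; rewrite ler_wpM2l ?mulr_ge0 //.
    by have := aKL K L; rewrite r_eq0 mul0r subr_le0.
  have rp : 0 < x.2 by rewrite lt_neqAle eq_sym rn0.
  have := dual (fun K => x.1.1 K / x.2) (fun K => x.1.2 K / x.2).
  have E (u m : T -> R) : \sum_K u K / x.2 * m K = (\sum_K u K * m K) / x.2.
    by rewrite mulr_suml; apply: eq_bigr => K _; rewrite mulrAC.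
  rewrite !E -mulrBl ler_pdivrMr // [v * _]mulrC; apply=> K L.
  by rewrite -mulrBl ler_pdivrMr // mulrC.
have [l [l0 bE]] := farkas la lb ab.
pose g K L := l (Some (K, L)).
have bE' (phi psi : {ffun T -> R^o}) (r : R) :
    \sum_K psi K * m1 K - \sum_K phi K * m0 K - r * v =
    \sum_K \sum_L g K L * (psi L - phi K - r * c K L) - l None * r.
  rewrite [LHS](bE (phi, psi, r)) (bigD1 None) //= addrC pair_big /= mulrN; congr (_ - _).
  rewrite (reindex_omap Some id) /=; last by case.
  by apply: eq_big => [[K L]|[K L] _] //=; rewrite eqxx.
(* The identity [bE'] is tested on indicators of one point for the marginals and on [(0, 0, 1)] for
   the cost. *)
exists g; split => [K L|K|L|]; first exact: l0.
- have := bE' [ffun L => (L == K)%:R] 0 0.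
  rewrite !mul0r !subr0 mulr0 subr0.
  rewrite big1 => [|L _]; last by rewrite ffunE mul0r.
  rewrite (bigD1 K) //= ffunE eqxx mul1r big1 ?addr0 => [|L /negbTE LK]; last first.
    by rewrite ffunE LK mul0r.
  rewrite [X in _ = X](bigD1 K) //= [X in _ = _ + X]big1 ?addr0 => [|K' /negbTE K'K]; last first.
    by apply: big1 => L _; rewrite !ffunE K'K mul0r !subr0 mulr0.
  rewrite sub0r => /eqP; rewrite eqr_oppLR -sumrN => /eqP ->.
  by apply: eq_bigr => L _; rewrite !ffunE eqxx mul0r subr0 sub0r mulrN1 opprK.
- have := bE' 0 [ffun K => (K == L)%:R] 0.
  rewrite !mul0r !subr0 mulr0 subr0.
  rewrite [X in _ - X]big1 => [|K _]; last by rewrite ffunE mul0r.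
  rewrite (bigD1 L) //= ffunE eqxx mul1r big1 ?addr0 ?subr0 => [|K /negbTE KL]; last first.
    by rewrite ffunE KL mul0r.
  move=> ->; apply: eq_bigr => K _.
  rewrite (bigD1 L) //= !ffunE eqxx mul0r !subr0 mulr1 big1 ?addr0 // => L' /negbTE L'L.
  by rewrite !ffunE L'L mul0r !subr0 mulr0.
- have := bE' 0 0 1; rewrite !mul1r mulr1.
  rewrite [X in X - _ - _]big1 => [|K _]; last by rewrite ffunE mul0r.
  rewrite [X in _ - X - _]big1 => [|K _]; last by rewrite ffunE mul0r.
  rewrite !sub0r oppr0 sub0r => h.
  rewrite -lerN2 h lerBlDr -sumrN (_ : \sum_K _ = \sum_K - \sum_L g K L * c K L).
    by rewrite lerDl.
  apply: eq_bigr => K _; rewrite -sumrN; apply: eq_bigr => L _.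
  by rewrite !ffunE mul1r; ring.
Qed.

End TransportDuality.

(** * Soft minimum and Hamilton-Jacobi subsolutions *)

Section BigDerive.
Context {R : realType}.

Lemma is_derive_big (J : Type) (r : seq J) (h : J -> R -> R) (dh : J -> R) (x : R) :
  (forall i, is_derive x 1 (h i) (dh i)) ->
  is_derive x 1 (fun t => \sum_(i <- r) h i t) (\sum_(i <- r) dh i).
Proof.
move=> hd; elim: r => [|i r IH].
  under [X in is_derive _ _ X]eq_fun do rewrite big_nil.
  by rewrite big_nil; exact: is_derive_cst.
under [X in is_derive _ _ X]eq_fun do rewrite big_cons.
by rewrite big_cons; apply: is_deriveD.
Qed.

End BigDerive.

Section SoftMin.
Context {R : realType} (T : finType) (k0 : T) (e : R).
Hypothesis e_gt0 : 0 < e.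
Implicit Types q z : T -> R.

(** Partition function of the energies [q] at temperature [e]; [softmin] is the free energy, and the
    Gibbs weights [gibbs] are its gradient in [q]. *)
Definition gibbs_sum q := \sum_k expR (- q k / e).

Definition softmin q := - e * ln (gibbs_sum q).

Definition gibbs q k := expR (- q k / e) / gibbs_sum q.

Lemma gibbs_sum_gt0 q : 0 < gibbs_sum q.
Proof.
rewrite /gibbs_sum (bigD1 k0) //= ltr_pwDl ?expR_gt0 //.
by apply: sumr_ge0 => k _; exact: expR_ge0.
Qed.

Lemma gibbs_ge0 q k : 0 <= gibbs q k.
Proof. by rewrite divr_ge0 ?expR_ge0 // ltW // gibbs_sum_gt0. Qed.

Lemma gibbs1 q : \sum_k gibbs q k = 1.
Proof. by rewrite -mulr_suml divff // gt_eqF // gibbs_sum_gt0. Qed.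

Lemma gibbs_mean_le q (f : T -> R) c : (forall k, f k <= c) ->
  \sum_k gibbs q k * f k <= c.
Proof.
move=> fc; rewrite -[leRHS]mul1r -[X in X * _](gibbs1 q) mulr_suml.
by apply: ler_sum => k _; rewrite ler_wpM2l ?gibbs_ge0.
Qed.

Lemma softmin_le q k : softmin q <= q k.
Proof.
rewrite /softmin mulNr lerNl -ler_pdivrMl // mulrC -[leLHS]expRK.
rewrite ler_ln ?posrE ?expR_gt0 ?gibbs_sum_gt0 // /gibbs_sum (bigD1 k) //=.
by rewrite lerDl sumr_ge0 // => j _; exact: expR_ge0.
Qed.

Lemma softmin_ge q c : (forall k, c <= q k) -> c - e * ln #|T|%:R <= softmin q.
Proof.
move=> cq.
have T0 : 0 < #|T|%:R :> R by rewrite ltr0n; apply/card_gt0P; exists k0.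
have : gibbs_sum q <= #|T|%:R * expR (- c / e).
  rewrite mulr_natl -sumr_const [leRHS](eq_bigl xpredT) //; apply: ler_sum => k _.
  by rewrite ler_expR ler_wpM2r ?invr_ge0 ?(ltW e_gt0) // lerN2.
rewrite -ler_ln ?posrE ?gibbs_sum_gt0 ?mulr_gt0 ?expR_gt0 //.
rewrite lnM ?posrE ?expR_gt0 // expRK => h.
rewrite /softmin mulNr.
have := ler_wpM2l (ltW e_gt0) h; rewrite mulrDr [e * (_ / e)]mulrC divfK ?gt_eqF //; lra.
Qed.

(** A change of the energies enters only through an exponential moment under the Gibbs weights.
    Hence [softmin_shift] is exact, and both Taylor bounds below reduce to inequalities for
    [expR]. *)
Lemma gibbs_sum_shift q z :
  gibbs_sum (fun k => q k + e * z k) / gibbs_sum q = \sum_k gibbs q k * expR (- z k).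
Proof.
rewrite mulr_suml; apply: eq_bigr => k _.
rewrite /gibbs opprD mulrDl expRD mulrAC; congr (_ * expR _).
by rewrite mulNr mulrAC mulfV ?mul1r // gt_eqF.
Qed.

Lemma softmin_shift q z :
  softmin (fun k => q k + e * z k) - softmin q = - e * ln (\sum_k gibbs q k * expR (- z k)).
Proof.
by rewrite -gibbs_sum_shift /softmin -mulrBr -ln_div ?posrE ?gibbs_sum_gt0.
Qed.

(** Concavity of the soft minimum: Jensen's inequality for the exponential, from its tangent at the
    mean [Z]. *)
Lemma softmin_shift_le q z :
  softmin (fun k => q k + e * z k) - softmin q <= e * \sum_k gibbs q k * z k.
Proof.
set Z := \sum_k _; rewrite softmin_shift mulNr lerNl -mulrN ler_pM2l //.
rewrite -[leLHS]expRK.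
have h : expR (- Z) <= \sum_k gibbs q k * expR (- z k).
  rewrite -[leLHS]mulr1 -[X in _ * X <= _](_ : \sum_k gibbs q k * (1 + (Z - z k)) = 1); last first.
    under eq_bigr do rewrite mulrDr mulr1 mulrBr.
    by rewrite big_split /= gibbs1 sumrB -mulr_suml gibbs1 mul1r subrr addr0.
  rewrite mulr_sumr; apply: ler_sum => k _.
  rewrite mulrCA ler_wpM2l ?gibbs_ge0 //.
  rewrite [X in _ <= expR X](_ : _ = - Z + (Z - z k)); last by rewrite addKr.
  by rewrite expRD ler_wpM2l ?expR_ge0 // expR_ge1Dx.
by rewrite ler_ln ?posrE ?expR_gt0 // (lt_le_trans _ h) // expR_gt0.
Qed.

(** From [expR (- x) >= 1 - x] and [(1 - x) * (1 + x + 2 * x ^+ 2) = 1 + x ^+ 2 * (1 - 2 * x)]. *)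
Lemma expR_le_quadratic (x : R) : x <= 2^-1 -> expR x <= 1 + x + 2 * x ^+ 2.
Proof.
move=> x2; have h := expR_ge1Dx (- x); have h0 := expR_gt0 x.
have E : expR (- x) * expR x = 1 by rewrite -expRD addNr expR0.
have h1 : (1 - x) * expR x <= 1 by rewrite -[leRHS]E ler_wpM2r // ltW.
have p : 0 < 1 - x by lra.
rewrite -(ler_pM2l p) (le_trans h1) //.
have : 0 <= x ^+ 2 * (1 - 2 * x) by rewrite mulr_ge0 ?sqr_ge0 //; lra.
by rewrite !expr2; nra.
Qed.

(** The exponential moment [S] satisfies [ln S <= S - 1], and its terms are expanded by the
    quadratic bound, whence the smallness of [z]. *)
Lemma softmin_shift_ge q z : (forall k, `|z k| <= 2^-1) ->
  e * \sum_k gibbs q k * z k - 2 * e * \sum_k gibbs q k * z k ^+ 2 <=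
  softmin (fun k => q k + e * z k) - softmin q.
Proof.
move=> z2; set Z := \sum_k _; set Z2 := \sum_k _.
rewrite softmin_shift mulNr lerNr opprB [2 * e]mulrC -mulrA -mulrBr ler_pM2l //.
set S := \sum_k _.
have S0 : 0 < S.
  by rewrite /S -gibbs_sum_shift divr_gt0 // gibbs_sum_gt0.
have : S <= 1 + (2 * Z2 - Z).
  rewrite /S -{1}(gibbs1 q) /Z /Z2 mulr_sumr -sumrB -big_split /=.
  apply: ler_sum => k _; have := @expR_le_quadratic (- z k).
  have /ler_normlP[zk _] := z2 k; move=> /(_ zk) h.
  have := ler_wpM2l (gibbs_ge0 q k) h; rewrite sqrrN; lra.
have := @ln_sublinear R S; have := expR_ge1Dx (ln S); rewrite lnK ?posrE //; lra.
Qed.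

Lemma softmin_dist q q' c : (forall k, `|q k - q' k| <= c) ->
  `|softmin q - softmin q'| <= c.
Proof.
move=> qq.
suff H p p' : (forall k, p k <= p' k + c) -> softmin p - softmin p' <= c.
  apply/ler_normlP; split; last by apply: H => k; have /ler_normlP[] := qq k; lra.
  by rewrite opprB; apply: H => k; have /ler_normlP[] := qq k; lra.
move=> pp; pose z k := (p k - p' k) / e.
have -> : softmin p = softmin (fun k => p' k + e * z k).
  by congr softmin; apply/funext => k; rewrite /z mulrC divfK ?gt_eqF // addrC subrK.
apply: le_trans (softmin_shift_le _ _) _; rewrite mulrC -ler_pdivlMr //.
apply: gibbs_mean_le => k; rewrite ler_pM2r ?invr_gt0 //.
by have := pp k; lra.
Qed.

Lemma is_derive_softmin (q : T -> R -> R) (dq : T -> R) (t : R) :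
  (forall k, is_derive t 1 (q k) (dq k)) ->
  is_derive t 1 (fun s => softmin (fun k => q k s))
    (\sum_k gibbs (fun k => q k t) k * dq k).
Proof.
move=> qd; set G := gibbs_sum (fun k => q k t).
have G0 : 0 < G by exact: gibbs_sum_gt0.
have Gd : is_derive t 1 (fun s => gibbs_sum (fun k => q k s))
    (\sum_k expR (- q k t / e) * (- dq k / e)).
  apply: is_derive_big => k.
  have h : is_derive t 1 (fun s => - q k s / e) (- dq k / e).
    rewrite (_ : (fun s => _) = (e^-1 \*: (- q k))); last first.
      by apply/funext => s /=; rewrite /GRing.scale /= mulrC.
    rewrite (_ : - dq k / e = e^-1 *: - dq k); last by rewrite /GRing.scale /= mulrC.
    exact: is_deriveZ.
  exact: (is_derive1_comp (is_derive_expR _) h).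
have := is_derive1_comp (is_derive1_ln G0) Gd.
move=> /(@is_deriveZ _ _ _ _ (- e) _ _ _).
rewrite (_ : _ *: _ = \sum_k gibbs (fun k => q k t) k * dq k) //.
rewrite /GRing.scale /= !mulr_sumr; apply: eq_bigr => k _.
rewrite /gibbs -/G; field; by rewrite !gt_eqF.
Qed.

End SoftMin.

(** * Euclidean inner product and norm *)

Section Euclid.
Context {R : realType} {d : nat}.
Implicit Types x y z : 'rV[R]_d.

Lemma edotC x y : edot x y = edot y x.
Proof. by apply: eq_bigr => i _; rewrite mulrC. Qed.

Lemma edotDl x y z : edot (x + y) z = edot x z + edot y z.
Proof. by rewrite -big_split; apply: eq_bigr => i _; rewrite mxE mulrDl. Qed.

Lemma edotZl (k : R) x y : edot (k *: x) y = k * edot x y.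
Proof. by rewrite mulr_sumr; apply: eq_bigr => i _; rewrite mxE mulrA. Qed.

Lemma edotNl x y : edot (- x) y = - edot x y.
Proof. by rewrite -scaleN1r edotZl mulN1r. Qed.

Lemma edotDr x y z : edot x (y + z) = edot x y + edot x z.
Proof. by rewrite edotC edotDl !(edotC _ x). Qed.

Lemma edotZr (k : R) x y : edot x (k *: y) = k * edot x y.
Proof. by rewrite edotC edotZl edotC. Qed.

Lemma edotNr x y : edot x (- y) = - edot x y.
Proof. by rewrite edotC edotNl edotC. Qed.

Definition edotE := (edotDl, edotDr, edotNl, edotNr, edotZl, edotZr).

Lemma edot_suml (T : finType) (F : T -> 'rV[R]_d) x :
  edot (\sum_k F k) x = \sum_k edot (F k) x.
Proof.
rewrite /edot exchange_big; apply: eq_bigr => i _ /=.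
by rewrite summxE mulr_suml.
Qed.

Lemma edot_ge0 x : 0 <= edot x x.
Proof. by apply: sumr_ge0 => i _; rewrite -expr2 sqr_ge0. Qed.

Lemma enorm_ge0 x : 0 <= enorm x.
Proof. exact: sqrtr_ge0. Qed.

Lemma enorm_sqr x : enorm x ^+ 2 = edot x x.
Proof. by rewrite sqr_sqrtr // edot_ge0. Qed.

Lemma enormN x : enorm (- x) = enorm x.
Proof. by rewrite /enorm edotNl edotNr opprK. Qed.

Lemma enormB x y : enorm (x - y) = enorm (y - x).
Proof. by rewrite -enormN opprB. Qed.

Lemma edot_eq0 x : edot x x = 0 -> x = 0.
Proof.
move/eqP; rewrite psumr_eq0 => [/allP h|i _]; last by rewrite -expr2 sqr_ge0.
apply/rowP => i; have := h i (mem_index_enum _).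
by rewrite -expr2 sqrf_eq0 mxE => /eqP.
Qed.

Lemma edot_cauchy_schwarz x y : `|edot x y| <= enorm x * enorm y.
Proof.
rewrite -(@ler_sqr _ `|_|) ?nnegrE ?mulr_ge0 ?enorm_ge0 //.
rewrite exprMn !enorm_sqr real_normK ?num_real //.
have [y0|yn0] := eqVneq (edot y y) 0.
  by rewrite y0 mulr0 (edot_eq0 y0) /edot big1 ?expr0n // => i _; rewrite mxE mulr0.
have yp : 0 < edot y y by rewrite lt_neqAle eq_sym yn0 edot_ge0.
have := edot_ge0 (edot y y *: x - edot x y *: y).
rewrite !edotE (edotC y x) => h.
have : 0 <= edot y y * (edot x x * edot y y - edot x y ^+ 2).
  by apply: le_trans h _; rewrite le_eqVlt; apply/orP; left; apply/eqP; ring.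
by rewrite pmulr_rge0 // subr_ge0.
Qed.

Lemma enormD x y : enorm (x + y) <= enorm x + enorm y.
Proof.
rewrite -ler_sqr ?nnegrE ?addr_ge0 ?enorm_ge0 // sqrrD !enorm_sqr !edotE (edotC y x).
have := edot_cauchy_schwarz x y; move=> /(le_trans (ler_norm _)).
by rewrite mulr2n; lra.
Qed.

Lemma enorm_triangle z x y : enorm (x - y) <= enorm (x - z) + enorm (z - y).
Proof. by rewrite -(subrKA z); exact: enormD. Qed.

(** The difference of the two sides is the variance of [F] under the weights [w]. *)
Lemma edot_jensen (T : finType) (w : T -> R) (F : T -> 'rV[R]_d) :
  (forall k, 0 <= w k) -> \sum_k w k = 1 ->
  edot (\sum_k w k *: F k) (\sum_k w k *: F k) <= \sum_k w k * edot (F k) (F k).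
Proof.
move=> w0 w1; set p := \sum_k _.
have : 0 <= \sum_k w k * edot (F k - p) (F k - p).
  by apply: sumr_ge0 => k _; rewrite mulr_ge0 // edot_ge0.
rewrite (_ : \sum_k _ = \sum_k w k * edot (F k) (F k) - edot p p) ?subr_ge0 //.
have -> : \sum_k w k * edot (F k - p) (F k - p) =
    \sum_k w k * edot (F k) (F k) - 2 * \sum_k edot (w k *: F k) p + (\sum_k w k) * edot p p.
  rewrite mulr_suml mulr_sumr -sumrB -big_split /=; apply: eq_bigr => k _.
  by rewrite !edotE (edotC p); ring.
by rewrite -edot_suml -/p w1; ring.
Qed.

End Euclid.

(** * The Hamilton-Jacobi subsolution and its expansions *)

Section TestFunction.
Context {R : realType} {d : nat} (T : finType) (k0 : T) (y : T -> 'rV[R]_d).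
Variables (phi : T -> R) (D s e : R).
Hypotheses (e_gt0 : 0 < e) (s_gt0 : 0 < s) (D_ge0 : 0 <= D).
Implicit Types (t : R) (x : 'rV[R]_d).

(* By Jensen's inequality ([hj_grad_speed]) and [is_derive_hj], [hj] satisfies
[d_t hj + |hj_grad|^2 / 2 <= 0]; the shift [s] removes the singularity of the
kernel at time 0. *)
Definition hj_cost t x k := edot (x - y k) (x - y k) / (2 * (s + t)) + phi k.

Definition hj t x := softmin e (hj_cost t x).

Definition hj_gibbs t x := gibbs e (hj_cost t x).

(** Gibbs mean of the squared velocities, while [hj_grad] is the mean velocity; the gap between the
    two makes [hj] a subsolution instead of a solution. *)
Definition hj_speed t x :=
  \sum_k hj_gibbs t x k * (edot (x - y k) (x - y k) / (s + t) ^+ 2).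

Definition hj_grad t x := \sum_k hj_gibbs t x k *: ((s + t)^-1 *: (x - y k)).

Lemma is_derive_hj t x : 0 <= t ->
  is_derive t 1 (fun r => hj r x) (- hj_speed t x / 2).
Proof.
move=> t0; have st : 0 < s + t by rewrite ltr_wpDr.
rewrite (_ : - hj_speed t x / 2 =
    \sum_k hj_gibbs t x k * (- edot (x - y k) (x - y k) / (2 * (s + t) ^+ 2))); last first.
  rewrite /hj_speed mulNr mulr_suml -sumrN; apply: eq_bigr => k _.
  by field; rewrite gt_eqF.
apply: is_derive_softmin => // k; rewrite /hj_cost.
set c := edot _ _.
have h1 : is_derive t 1 (fun r : R => (2 * (s + r))) 2.
  have : is_derive t 1 (2 \*: (cst s + id) : R -> R) (2 *: (0 + 1) : R).
    by apply: is_deriveZ; apply: is_deriveD.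
  by rewrite add0r /GRing.scale /= mulr1.
have n0 : 2 * (s + t) != 0 by rewrite gt_eqF ?mulr_gt0.
have h2 := @is_deriveV R (fun r : R => 2 * (s + r)) t 2 1 n0 h1.
have h3 : is_derive t 1 (c \*: (fun r : R => (2 * (s + r))^-1) + cst (phi k))%R
   (c *: (- (2 * (s + t)) ^- 2 *: 2) + 0) by apply: is_deriveD.
move: h3; rewrite (_ : _ + 0 = - c / (2 * (s + t) ^+ 2)) //.
by rewrite addr0 /GRing.scale /=; field; rewrite gt_eqF.
Qed.

Lemma hj_grad_speed t x : edot (hj_grad t x) (hj_grad t x) <= hj_speed t x.
Proof.
apply: le_trans (edot_jensen _ _ _) _.
- by move=> k; exact: gibbs_ge0.
- exact: gibbs1.
- apply: ler_sum => k _; rewrite !edotE -exprVn.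
  by rewrite le_eqVlt; apply/orP; left; apply/eqP; ring.
Qed.

Lemma hj_speed_ge0 t x : 0 <= hj_speed t x.
Proof. exact: le_trans (edot_ge0 _) (hj_grad_speed _ _). Qed.

Lemma hj_speed_le t x : 0 <= t -> (forall k, enorm (x - y k) <= D) ->
  hj_speed t x <= (D / s) ^+ 2.
Proof.
have [s0 e0 D0] : [/\ 0 < s, 0 < e & 0 <= D] by [].
move=> t0 xD; apply: gibbs_mean_le => // k; rewrite -enorm_sqr expr_div_n.
rewrite ler_pM ?sqr_ge0 ?invr_ge0 ?sqr_ge0 // ?ler_sqr ?nnegrE ?enorm_ge0 //.
by rewrite lef_pV2 ?posrE ?exprn_gt0 ?ler_sqr ?nnegrE //; lra.
Qed.

Lemma hj0_le k : hj 0 (y k) <= phi k.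
Proof.
apply: le_trans (softmin_le k0 e_gt0 _ k) _.
by rewrite /hj_cost subrr /edot big1 ?mul0r ?add0r // => i _; rewrite mxE mul0r.
Qed.

Lemma hj_ge t x c : (forall k, c <= hj_cost t x k) -> c - e * ln #|T|%:R <= hj t x.
Proof. exact: softmin_ge. Qed.

(** The difference of squares factors as [<x - x', (x - y k) + (x' - y k)>], which is at most
    [2 * D * |x - x'|], and the kernel divides by at least [2 * s]. *)
Lemma hj_lipschitz t x x' : 0 <= t -> (forall k, enorm (x - y k) <= D) ->
  (forall k, enorm (x' - y k) <= D) ->
  `|hj t x - hj t x'| <= D / s * enorm (x - x').
Proof.
have [s0 e0 D0] : [/\ 0 < s, 0 < e & 0 <= D] by [].
move=> t0 xD x'D; apply: softmin_dist => // k.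
rewrite /hj_cost opprD addrACA subrr addr0 -mulrBl.
have -> : edot (x - y k) (x - y k) - edot (x' - y k) (x' - y k) =
    edot (x - x') ((x - y k) + (x' - y k)).
  by rewrite !edotE !(edotC (y k)) (edotC x' x); ring.
rewrite normrM (@ger0_norm _ _^-1) ?invr_ge0; last by lra.
rewrite ler_pdivrMr; last by lra.
apply: le_trans (edot_cauchy_schwarz _ _) _.
rewrite [leRHS]mulrAC mulrC ler_wpM2r ?enorm_ge0 //.
apply: le_trans (enormD _ _) _.
apply: (@le_trans _ _ (D / s * (2 * s))).
  rewrite mulrCA divfK ?gt_eqF //; have := xD k; have := x'D k; lra.
by rewrite ler_wpM2l ?divr_ge0 ?(ltW s_gt0) //; lra.
Qed.

Lemma hj_time_lipschitz t t' x : 0 <= t -> t <= t' -> (forall k, enorm (x - y k) <= D) ->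
  `|hj t x - hj t' x| <= (D / s) ^+ 2 * (t' - t).
Proof.
have [s0 e0 D0] : [/\ 0 < s, 0 < e & 0 <= D] by [].
move=> t0 tt xD; apply: softmin_dist => // k.
rewrite /hj_cost opprD addrACA subrr addr0 -mulrBr -enorm_sqr.
have -> : (2 * (s + t))^-1 - (2 * (s + t'))^-1 = (t' - t) / (2 * (s + t) * (s + t')).
  by field; rewrite !gt_eqF //; lra.
rewrite ger0_norm; last first.
  by rewrite mulr_ge0 ?sqr_ge0 // divr_ge0 ?subr_ge0 // !mulr_ge0 //; lra.
rewrite expr_div_n -[leRHS]mulrA ler_pM ?sqr_ge0 //.
- by rewrite divr_ge0 ?subr_ge0 // !mulr_ge0 //; lra.
- by rewrite ler_sqr ?nnegrE ?enorm_ge0.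
- rewrite mulrC ler_wpM2r ?subr_ge0 // lef_pV2 ?posrE ?exprn_gt0 // ?mulr_gt0 //; try lra.
  by rewrite expr2; nra.
Qed.

(** The first term comes from [|h|^2 / (2 * (s + t))], the second from [2 * e * z ^+ 2] in
    [softmin_shift_ge] with [|z| <= 3 * D * |h| / (2 * s * e)]. *)
Definition hj_const := (2 * s)^-1 + 9 * D ^+ 2 / (2 * s ^+ 2 * e).

Lemma hj_const_ge0 : 0 <= hj_const.
Proof.
by rewrite addr_ge0 ?invr_ge0 ?divr_ge0 ?mulr_ge0 ?sqr_ge0 ?(ltW s_gt0) ?(ltW e_gt0).
Qed.

(** The costs are quadratic in [x], so [e * z] is their exact increment and nothing is
    differentiated in space. The bound [|h| <= D] gives [|2 * <x - y k, h> + |h|^2| <= 3 * D * |h|],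
    and the last condition makes [|z| <= 1 / 2]. *)
Lemma hj_taylor t x x' : 0 <= t -> (forall k, enorm (x - y k) <= D) ->
  enorm (x' - x) <= D -> 3 * D * enorm (x' - x) <= s * e ->
  `|hj t x' - hj t x - edot (hj_grad t x) (x' - x)| <=
  hj_const * enorm (x' - x) ^+ 2.
Proof.
have [s0 e0 D0] : [/\ 0 < s, 0 < e & 0 <= D] by [].
move=> t0 xD hD hse; set h := x' - x; set n := enorm h.
have st : 0 < s + t by rewrite ltr_wpDr.
pose z k := (2 * edot (x - y k) h + edot h h) / (2 * (s + t) * e).
have n0 : 0 <= n by exact: enorm_ge0.
have zb k : `|z k| <= 3 * D * n / (2 * s * e).
  rewrite normrM (@ger0_norm _ _^-1) ?invr_ge0 ?mulr_ge0 //; try lra.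
  apply: ler_pM; rewrite ?invr_ge0 ?mulr_ge0 //; try lra.
    apply: le_trans (ler_normD _ _) _; rewrite (ger0_norm (edot_ge0 _)) -enorm_sqr -/n.
    rewrite normrM ger0_norm //.
    have := edot_cauchy_schwarz (x - y k) h; rewrite -/n => h1.
    have h2 : enorm (x - y k) * n <= D * n by rewrite ler_wpM2r.
    have h3 : n ^+ 2 <= D * n by rewrite expr2 ler_wpM2r.
    lra.
  rewrite lef_pV2 ?posrE ?mulr_gt0 //; try lra.
  by rewrite ler_wpM2r ?(ltW e_gt0) //; lra.
have zh k : `|z k| <= 2^-1.
  apply: le_trans (zb k) _; rewrite ler_pdivrMr ?mulr_gt0 //.
  by rewrite -/n -/h in hse; lra.
have -> : hj t x' = softmin e (fun k => hj_cost t x k + e * z k).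
  congr softmin; apply/funext => k; rewrite /hj_cost /z.
  rewrite (_ : x' - y k = (x - y k) + h); last by rewrite [RHS]addrC /h addrA subrK.
  move: (x - y k) (h) => w v; rewrite !edotE (edotC v w).
  by field; rewrite !gt_eqF.
have gE : e * (\sum_k hj_gibbs t x k * z k) = edot (hj_grad t x) h + edot h h / (2 * (s + t)).
  have -> : edot h h / (2 * (s + t)) = \sum_k hj_gibbs t x k * (edot h h / (2 * (s + t))).
    by rewrite -mulr_suml gibbs1 ?mul1r.
  rewrite /hj_grad edot_suml mulr_sumr -big_split; apply: eq_bigr => k _ /=.
  by rewrite !edotZl /z; field; rewrite !gt_eqF.
have up := softmin_shift_le k0 e_gt0 (hj_cost t x) z.
have lo := softmin_shift_ge k0 e_gt0 (hj_cost t x) zh.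
rewrite -/(hj t x) -/(hj_gibbs t x) gE in up lo.
have z2 : \sum_k hj_gibbs t x k * z k ^+ 2 <= (3 * D * n / (2 * s * e)) ^+ 2.
  apply: gibbs_mean_le => // k.
  rewrite -real_normK ?num_real // ler_sqr ?nnegrE //.
  exact: le_trans (normr_ge0 _) (zb k).
have z20 : 0 <= \sum_k hj_gibbs t x k * z k ^+ 2.
  by apply: sumr_ge0 => k _; rewrite mulr_ge0 ?sqr_ge0 ?gibbs_ge0.
have h0 : 0 <= edot h h / (2 * (s + t)) by rewrite divr_ge0 ?edot_ge0 //; lra.
have h1 : edot h h / (2 * (s + t)) <= (2 * s)^-1 * n ^+ 2.
  rewrite /n enorm_sqr mulrC ler_wpM2r ?edot_ge0 // lef_pV2 ?posrE; lra.
have h2 : 2 * e * (\sum_k hj_gibbs t x k * z k ^+ 2) <= 9 * D ^+ 2 / (2 * s ^+ 2 * e) * n ^+ 2.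
  apply: le_trans (ler_wpM2l _ z2) _; first by rewrite mulr_ge0 // ltW.
  rewrite le_eqVlt; apply/orP; left; apply/eqP; field; rewrite !gt_eqF //.
have h3 : 0 <= 9 * D ^+ 2 / (2 * s ^+ 2 * e) * n ^+ 2.
  by rewrite mulr_ge0 ?sqr_ge0 // divr_ge0 ?mulr_ge0 ?sqr_ge0 // ltW.
have h4 : 0 <= (2 * s)^-1 * n ^+ 2 by rewrite mulr_ge0 ?sqr_ge0 // invr_ge0; lra.
rewrite /hj_const mulrDl; apply/ler_normlP; split; lra.
Qed.

(** With the increment written as [b + c], where [|b| <= D / s * n] and [|c| <= hj_const * n ^+ 2],
    the terms [2 * b * c] and [c ^+ 2] have order 3 and 4 in [n]; the powers beyond [n ^+ 2] are
    traded for [r]. *)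
Lemma hj_increment t x x' r : 0 <= t -> (forall k, enorm (x - y k) <= D) ->
  enorm (x' - x) <= D -> 3 * D * enorm (x' - x) <= s * e -> enorm (x' - x) <= r ->
  (hj t x' - hj t x) ^+ 2 <= edot (hj_grad t x) (x' - x) ^+ 2 +
    (2 * (D / s) * hj_const * r + hj_const ^+ 2 * r ^+ 2) * enorm (x' - x) ^+ 2.
Proof.
have [s0 e0 D0] : [/\ 0 < s, 0 < e & 0 <= D] by [].
move=> t0 xD hD hse hr; have := hj_taylor t0 xD hD hse.
set C := hj_const.
set n := enorm _ in hr *; set a := hj t x' - _; set b := edot _ _.
have n0 : 0 <= n by exact: enorm_ge0.
have C0 : 0 <= C by exact: hj_const_ge0.
have Ds0 : 0 <= D / s by rewrite divr_ge0 // ltW.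
have bD : `|b| <= D / s * n.
  apply: le_trans (edot_cauchy_schwarz _ _) _; rewrite ler_wpM2r ?enorm_ge0 //.
  rewrite -ler_sqr ?nnegrE ?enorm_ge0 // enorm_sqr.
  by apply: le_trans (hj_grad_speed _ _) (hj_speed_le _ _).
move=> abC; pose c := a - b.
have -> : a = b + c by rewrite /c addrC subrK.
rewrite sqrrD -addrA lerD2l mulrDl; apply: lerD.
  rewrite -mulr_natl.
  have bc : b * c <= D / s * n * (C * n ^+ 2).
    by rewrite (le_trans (ler_norm _)) // normrM ler_pM.
  have : D / s * n * (C * n ^+ 2) <= D / s * r * (C * n ^+ 2).
    by rewrite ler_wpM2r ?mulr_ge0 ?sqr_ge0 // ler_wpM2l.
  rewrite !expr2 in bc *; lra.
rewrite -real_normK ?num_real //.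
apply: (@le_trans _ _ ((C * n ^+ 2) ^+ 2)).
  by rewrite ler_sqr ?nnegrE ?mulr_ge0 ?sqr_ge0.
rewrite exprMn -[leRHS]mulrA ler_wpM2l ?sqr_ge0 // (expr2 (n ^+ 2)) ler_wpM2r ?sqr_ge0 //.
by rewrite ler_sqr ?nnegrE // (le_trans n0).
Qed.

End TestFunction.

(** * Upper bound on the discrete action *)

Section MeanBound.
Context {R : realType}.

Lemma derivable_increment (f : R -> R) (x : R) : derivable f x 1 ->
  forall e : R, 0 < e -> exists2 dt : R, 0 < dt & forall h, h != 0 -> `|h| < dt ->
    `|derive1 f x - h^-1 * (f (h + x) - f x)| < e.
Proof.
move=> fx e e0.
have := fx; rewrite /derivable => /cvgrPdist_lt/(_ e e0).
move=> /nbhs_ballP[dt /= dt0 H]; exists dt => // h h0 hdt.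
have := H h; rewrite /ball /= sub0r normrN => /(_ hdt h0).
by rewrite derive1E /derive [h *: 1]mulr1.
Qed.

(** A concave function lies below its tangent: that of [theta a 1] at [a = 1] is
    [lam * a + (1 - lam)], and homogeneity extends the bound to all [b > 0]. *)
Lemma admissible_mean_le (theta : R -> R -> R) (lam : R) :
  admissible_mean theta -> derive1 (fun a => theta a 1) 1 = lam -> 0 <= lam <= 1 ->
  forall a b, 0 <= a -> 0 <= b -> theta a b <= lam * a + (1 - lam) * b.
Proof.
move=> [th0 [_ [thC [thh [thc th1]]]]] thd /andP[lam0 lam1].
have g_le a : 0 <= a -> theta a 1 <= lam * a + (1 - lam).
  move=> a0; have [->|a1] := eqVneq a 1; first by rewrite th1; lra.
  (* By concavity, an excess over the tangent at [a] is inherited proportionally at [1 + t * v] for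
     all [t] in []0, 1]], which contradicts the derivative at 1. *)
  rewrite leNgt; apply/negP => h.
  set v := a - 1; have v0 : v != 0 by rewrite subr_eq0.
  have vp : 0 < `|v| by rewrite normr_gt0.
  pose e := (theta a 1 - 1 - lam * v) / `|v|.
  have e0 : 0 < e by rewrite divr_gt0 // /v; lra.
  have dg : derivable (fun a => theta a 1) 1 1.
    by have [_ [/(_ 1 1 ltr01 ltr01)[]]] := thC 1%N.
  have [dt dt0 H] := derivable_increment dg e0.
  pose t := Num.min 1 (dt / (2 * `|v|)).
  have t0 : 0 < t by rewrite lt_min ltr01 /= divr_gt0 // mulr_gt0.
  have t1 : t <= 1 by rewrite ge_min lexx.
  have tdt : t * `|v| < dt.
    have : t <= dt / (2 * `|v|) by rewrite ge_min lexx orbT.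
    by rewrite ler_pdivlMr ?mulr_gt0 //; lra.
  have := H (t * v); rewrite mulf_neq0 ?(gt_eqF t0) // normrM (gtr0_norm t0).
  move=> /(_ isT tdt); rewrite th1 thd.
  have c := thc t a 1 1 1; rewrite th1 in c.
  have := c _ a0 ler01 ler01 ler01; rewrite (ltW t0) t1 => /(_ isT).
  rewrite (_ : t * a + (1 - t) * 1 = t * v + 1); last by rewrite /v; ring.
  rewrite (_ : t * 1 + (1 - t) * 1 = 1); last by ring.
  set q := theta (t * v + 1) 1 => hq.
  have hq' : theta a 1 - 1 <= t^-1 * (q - 1).
    by rewrite ler_pdivlMl //; lra.
  rewrite invfM => /ltr_normlP[h1 h2].
  have : `|v| * `|lam - t^-1 * v^-1 * (q - 1)| < `|v| * e by rewrite ltr_pM2l //; apply/ltr_normlP.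
  rewrite /e [`|v| * (_ / _)]mulrC divfK ?gt_eqF // -normrM => /ltr_normlP[h3 _].
  have E : v * (lam - t^-1 * v^-1 * (q - 1)) = lam * v - t^-1 * (q - 1).
    by field; rewrite v0 gt_eqF.
  by rewrite E in h3; lra.
have bpos a b : 0 <= a -> 0 < b -> theta a b <= lam * a + (1 - lam) * b.
  move=> a0 b0; have ab0 : 0 <= a / b by rewrite divr_ge0 // ltW.
  have := thh b _ _ b0 ab0 ler01; rewrite mulr1 mulrC divfK ?gt_eqF // => ->.
  apply: le_trans (ler_wpM2l (ltW b0) (g_le _ ab0)) _.
  by rewrite le_eqVlt; apply/orP; left; apply/eqP; field; rewrite gt_eqF.
(* For [b = 0], concavity between [(a, 0)] and [(0, 1)] with weights [t] and [1 - t = t * e] leads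
   back to the case [b > 0], with an error of at most [t * e]. *)
move=> a b a0; rewrite le_eqVlt => /predU1P[<-|]; last exact: bpos.
rewrite mulr0 addr0; apply/ler_addgt0Pr => e e0.
pose t := (1 + e)^-1.
have t0 : 0 < t by rewrite invr_gt0; lra.
have t1 : t < 1 by rewrite invf_lt1; lra.
have te : 1 - t = t * e by rewrite /t; field; rewrite gt_eqF //; lra.
have c := thc t a 0 0 1; have := c _ a0 (lexx 0) (lexx 0) ler01; rewrite (ltW t0) (ltW t1).
move=> /(_ isT); rewrite !mulr0 mulr1 addr0 add0r => {}c.
have ta0 : 0 <= t * a by rewrite mulr_ge0 // ltW.
have t10 : 0 < 1 - t by lra.
have := bpos _ _ ta0 t10.
have th01 := th0 0 1 (lexx 0) ler01; have := mulr_ge0 (ltW t10) th01.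
rewrite {3}te => h1 h2.
have : t * theta a 0 <= t * (lam * a + e).
  have : (1 - lam) * (t * e) <= t * e by rewrite ler_piMl ?mulr_ge0 ?(ltW t0) ?(ltW e0) //; lra.
  lra.
by rewrite ler_pM2l.
Qed.

End MeanBound.

Section ActionBound.
Context {R : realType} {d : nat} {Omega : set 'rV[R]_d} (T : mesh Omega).
Implicit Types K L : T.

Lemma cell_vol_ge0 K : 0 <= cell_vol K.
Proof.
apply: fine_ge0; apply: le_ereal_inf_tmp => _ [[a b] /= [ab _] <-].
apply: nneseries_ge0 => k _ _; rewrite lee_fin; apply: prodr_ge0 => i _.
by rewrite subr_ge0.
Qed.

Lemma face_measureC K L : face_measure K L = face_measure L K.
Proof. by rewrite /face_measure /face setIC. Qed.

Lemma face_areaC K L : face_area K L = face_area L K.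
Proof. by rewrite /face_area face_measureC. Qed.

Lemma nbrC K L : nbr K L = nbr L K.
Proof. by rewrite /nbr face_measureC eq_sym. Qed.

Lemma pt_distC K L : pt_dist K L = pt_dist L K.
Proof. by rewrite /pt_dist enormB. Qed.

Lemma face_area_ge0 K L : nbr K L -> 0 <= face_area K L.
Proof. by move=> /andP[_ h]; apply: fine_ge0; exact: ltW. Qed.

Variables (theta : T -> T -> R -> R -> R) (lambda : T -> T -> R) (eta : T -> R).
Hypotheses (theta_mean : mean_function theta) (lambda_weight : weight_function lambda)
  (theta_compatible : compatible theta lambda)
  (isotropic : forall K, loewner_le (isotropy_mx lambda K)
                            ((cell_vol K * (1 + eta K))%:M)).

Local Notation w K L := (face_area K L / pt_dist K L).

Lemma face_weight_ge0 K L : nbr K L -> 0 <= w K L.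
Proof. by move=> KL; rewrite divr_ge0 ?face_area_ge0 // enorm_ge0. Qed.

Lemma isotropy_form K (v : 'rV[R]_d) :
  \sum_(L : T | nbr K L) lambda K L * w K L * edot v (pt T K - pt T L) ^+ 2 <=
  cell_vol K * (1 + eta K) * edot v v.
Proof.
have := isotropic K v^T; rewrite trmxK.
rewrite (_ : (v *m isotropy_mx lambda K *m v^T) 0 0 =
    \sum_(L : T | nbr K L) lambda K L * w K L * edot v (pt T K - pt T L) ^+ 2).
  move/le_trans; apply; rewrite mul_mx_scalar -scalemxAl mxE.
  rewrite le_eqVlt; apply/orP; left; apply/eqP; congr (_ * _).
  by rewrite mxE; apply: eq_bigr => i _; rewrite mxE.
rewrite /isotropy_mx mulmx_sumr mulmx_suml summxE.
apply: eq_big => [L|L _]; first by rewrite nbrC.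
rewrite -scalemxAr -scalemxAl mxE; congr (_ * _).
set h := pt T K - pt T L.
have -> : v *m (h^T *m h) *m v^T = (v *m h^T) *m (h *m v^T) by rewrite !mulmxA.
rewrite mxE big_ord1 expr2; congr (_ * _).
  by rewrite mxE; apply: eq_bigr => i _; rewrite !mxE.
by rewrite mxE edotC; apply: eq_bigr => i _; rewrite !mxE.
Qed.

(** The quadratic forms are summed over the standard basis, which takes the trace of the isotropy
    condition. This absorbs the remainder [om * |x_K - x_L|^2] in [action_le]. *)
Lemma isotropy_trace K :
  \sum_(L : T | nbr K L) lambda K L * w K L * enorm (pt T K - pt T L) ^+ 2 <=
  cell_vol K * (1 + eta K) * d%:R.
Proof.
have e_i (i : 'I_d) (v : 'rV[R]_d) : edot (delta_mx 0 i) v = v 0 i.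
  rewrite /edot (bigD1 i) //= mxE !eqxx mul1r big1 ?addr0 // => j ji.
  by rewrite mxE (negbTE ji) andbF mul0r.
have -> : d%:R = \sum_(i < d) edot (delta_mx 0 i) (delta_mx 0 i : 'rV[R]_d).
  under eq_bigr do rewrite e_i mxE !eqxx.
  by rewrite sumr_const card_ord.
rewrite mulr_sumr (eq_bigr (fun L => \sum_(i < d) lambda K L * w K L *
    edot (delta_mx 0 i) (pt T K - pt T L) ^+ 2)); last first.
  move=> L _; rewrite enorm_sqr -mulr_sumr; congr (_ * _).
  by apply: eq_bigr => i _; rewrite e_i expr2.
by rewrite exchange_big; apply: ler_sum => i _; exact: isotropy_form.
Qed.

(** Exchanging [K] and [L] shows that both halves of the bound on the mean contribute the same sum,
    which cancels the factor 1/2 of the action. What remains splits over the cells [K], where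
    isotropy is applied to [p K], an approximate gradient at [x_K]. *)
Lemma action_le (m psi : T -> R) (p : T -> 'rV[R]_d) (om : R) :
  (forall K, 0 <= m K) -> (forall K, 0 <= 1 + eta K) -> 0 <= om ->
  (forall K L, nbr K L -> (psi K - psi L) ^+ 2 <=
     edot (p K) (pt T K - pt T L) ^+ 2 + om * enorm (pt T K - pt T L) ^+ 2) ->
  action theta m psi <= \sum_K m K * ((1 + eta K) * (edot (p K) (p K) + om * d%:R)).
Proof.
move=> m0 eta1 om0 psip.
pose a K := m K / cell_vol K.
have a0 K : 0 <= a K by rewrite divr_ge0 ?cell_vol_ge0.
have [lam01 lamC] := lambda_weight.
pose S := \sum_(K : T) \sum_(L : T | nbr K L) w K L * (lambda K L * a K) * (psi K - psi L) ^+ 2.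
have S' : \sum_(K : T) \sum_(L : T | nbr K L) w K L * (lambda L K * a L) * (psi K - psi L) ^+ 2 = S.
  rewrite (exchange_big_dep xpredT) //=; apply: eq_bigr => K _.
  apply: eq_big => [L|L _]; first by rewrite nbrC.
  by rewrite face_areaC pt_distC -(sqrrN (psi K - psi L)) opprB.
have : action theta m psi <= S.
  rewrite /action -/(a _) ler_pdivrMl // mulr2n mulrDl mul1r -{2}S' -big_split /=.
  apply: ler_sum => K _; rewrite -big_split /=; apply: ler_sum => L KL.
  rewrite -mulrDl -mulrDr ler_wpM2r ?sqr_ge0 // ler_wpM2l ?face_weight_ge0 //.
  rewrite (_ : lambda L K = 1 - lambda K L); last by have := lamC K L; lra.
  exact: (admissible_mean_le (theta_mean.1 K L) (theta_compatible K L) (lam01 K L) (a0 K) (a0 L)).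
move/le_trans; apply; apply: ler_sum => K _.
have : \sum_(L : T | nbr K L) w K L * (lambda K L * a K) * (psi K - psi L) ^+ 2 <=
   a K * (cell_vol K * (1 + eta K) * (edot (p K) (p K) + om * d%:R)).
  have h1 := isotropy_form K (p K).
  have h2 := ler_wpM2l om0 (isotropy_trace K).
  apply: (@le_trans _ _ (a K * (\sum_(L : T | nbr K L) lambda K L * w K L *
       (edot (p K) (pt T K - pt T L) ^+ 2 + om * enorm (pt T K - pt T L) ^+ 2)))).
    rewrite mulr_sumr; apply: ler_sum => L KL.
    rewrite [leRHS]mulrA (_ : a K * _ = w K L * (lambda K L * a K)); last by ring.
    rewrite ler_wpM2l ?psip // mulr_ge0 ?face_weight_ge0 // mulr_ge0 //.
    by have /andP[] := lam01 K L.
  rewrite ler_wpM2l //; under eq_bigr do rewrite mulrDr.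
  rewrite big_split /= mulrDr; apply: lerD => //.
  rewrite [leRHS]mulrCA; apply: le_trans h2.
  by rewrite mulr_sumr; apply: ler_sum => L _; rewrite mulrCA.
move/le_trans; apply; rewrite -[cell_vol K * _ * _]mulrA mulrA /a.
rewrite ler_wpM2r //.
  by rewrite mulr_ge0 ?eta1 // addr_ge0 ?edot_ge0 // mulr_ge0.
(* For a cell of volume 0 the density is 0 by the division convention, so the left side vanishes. *)
by have [->|v0] := eqVneq (cell_vol K) 0; [rewrite mulr0|rewrite divfK].
Qed.

End ActionBound.

(** * Lower bound on the energy of a curve *)

Section MinorantIntegral.
Context {dsp : measure_display} {X : measurableType dsp} {R : realType}.
Variable mu : {measure set X -> \bar R}.
Local Open Scope ereal_scope.

(* Unlike [ge0_le_integral], the larger function need not be measurable: the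
integral is a supremum over simple minorants. *)
Lemma ge0_le_integral_minorant (D1 D2 : set X) (f1 f2 : X -> \bar R) :
  D1 `<=` D2 -> (forall x, D1 x -> 0 <= f1 x) -> (forall x, D2 x -> 0 <= f2 x) ->
  (forall x, D1 x -> f1 x <= f2 x) ->
  \int[mu]_(x in D1) f1 x <= \int[mu]_(x in D2) f2 x.
Proof.
move=> D12 f10 f20 f12; rewrite !ge0_integralE //.
apply: le_ereal_sup => _ [h hf <-]; exists h => // x; apply: le_trans (hf x) _.
rewrite /patch; case: ifPn => [xD1|_].
  by rewrite mem_set ?f12 //; [exact: set_mem|apply: D12; exact: set_mem].
by case: ifPn => // /set_mem; exact: f20.
Qed.

Lemma le_integral_funepos (D : set X) (f : X -> \bar R) :
  \int[mu]_(x in D) f x <= \int[mu]_(x in D) f^\+ x.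
Proof.
rewrite integralE geeDl // oppe_le0.
by apply: integral_ge0 => x _; rewrite funeneg_ge0.
Qed.

(** Deleting a null set from [D1] does not change the integral of the integrable [f1], and on the
    rest the positive part of [f1] is below [f2] everywhere. In the application [f2] is the dual
    action along a curve, as a function of time. *)
Lemma ae_le_integral_minorant (D1 D2 : set X) (f1 f2 : X -> \bar R) :
  measurable D1 -> D1 `<=` D2 -> mu.-integrable D1 f1 ->
  (forall x, D2 x -> 0 <= f2 x) ->
  {ae mu, forall x, D1 x -> f1 x <= f2 x} ->
  \int[mu]_(x in D1) f1 x <= \int[mu]_(x in D2) f2 x.
Proof.
move=> mD1 D12 if1 f20 [N [mN N0 NP]].
rewrite (negligible_integral mN mD1 if1 N0).
apply: le_trans (le_integral_funepos _ _) _.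
apply: ge0_le_integral_minorant => //.
- by move=> x [/D12].
- move=> x [D1x Nx]; have f12 : f1 x <= f2 x.
    by apply: contrapT => h; apply: Nx; apply: NP => /= /(_ D1x).
  by rewrite funeposE ge_max f12 f20 //; exact: D12.
Qed.

End MinorantIntegral.

Section AbsContinuousSum.
Context {R : realType}.
Implicit Types f g : R -> R.

Lemma abs_continuous01_cst (c : R) : abs_continuous01 (cst c).
Proof.
move=> e e0; exists 1 => // n a b _ _ _.
by rewrite big1 // => k _; rewrite subrr normr0.
Qed.

Lemma abs_continuous01D f g : abs_continuous01 f -> abs_continuous01 g ->
  abs_continuous01 (fun t => f t + g t).
Proof.
move=> fA gA e e0; have e20 : 0 < e / 2 by lra.
have [d1 d10 H1] := fA _ e20; have [d2 d20 H2] := gA _ e20.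
exists (Num.min d1 d2); first by rewrite lt_min d10.
move=> n a b ab tab; rewrite lt_min => /andP[s1 s2].
have := H1 n a b ab tab s1; have := H2 n a b ab tab s2 => h2 h1.
apply: (@le_lt_trans _ _ (\sum_(k < n) (`|f (b k) - f (a k)| + `|g (b k) - g (a k)|))).
  by apply: ler_sum => k _; rewrite opprD addrACA ler_normD.
by rewrite big_split /=; lra.
Qed.

Lemma abs_continuous01_sum (J : Type) (r : seq J) (F : J -> R -> R) :
  (forall j, abs_continuous01 (F j)) -> abs_continuous01 (fun t => \sum_(j <- r) F j t).
Proof.
move=> FA; elim: r => [|j r IH].
  under [X in abs_continuous01 X]eq_fun do rewrite big_nil.
  exact: abs_continuous01_cst.
under [X in abs_continuous01 X]eq_fun do rewrite big_cons.
exact: (abs_continuous01D (FA j) IH).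
Qed.

Lemma abs_continuous01M_lipschitz f g (A B C : R) : abs_continuous01 f ->
  0 <= A -> 0 <= B -> 0 <= C ->
  (forall t, 0 <= t <= 1 -> `|f t| <= A) -> (forall t, 0 <= t <= 1 -> `|g t| <= B) ->
  (forall t t', 0 <= t -> t <= t' -> t' <= 1 -> `|g t' - g t| <= C * (t' - t)) ->
  abs_continuous01 (fun t => f t * g t).
Proof.
move=> fA A0 B0 C0 fb gb gC e e0.
(* Adding 1 to [B] and to [A * C] keeps the divisors positive. *)
have e1 : 0 < e / (2 * (B + 1)) by rewrite divr_gt0 // mulr_gt0 //; lra.
have [d1 d10 H1] := fA _ e1.
have AC0 : 0 <= A * C by rewrite mulr_ge0.
have e2 : 0 < e / (2 * (A * C + 1)) by rewrite divr_gt0 // mulr_gt0 //; lra.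
exists (Num.min d1 (e / (2 * (A * C + 1)))); first by rewrite lt_min d10.
move=> n a b ab tab; rewrite lt_min => /andP[s1 s2].
have h1 := H1 n a b ab tab s1.
have h2 : \sum_(k < n) `|f (b k) * g (b k) - f (a k) * g (a k)| <=
    B * (\sum_(k < n) `|f (b k) - f (a k)|) + A * C * \sum_(k < n) (b k - a k).
  rewrite !mulr_sumr -big_split; apply: ler_sum => k _ /=.
  have [a0 akb b1] := ab k.
  rewrite (_ : _ - _ = g (b k) * (f (b k) - f (a k)) + f (a k) * (g (b k) - g (a k))); last by ring.
  apply: le_trans (ler_normD _ _) _; rewrite !normrM; apply: lerD.
    by rewrite ler_wpM2r // gb // b1 (le_trans a0).
  by rewrite -mulrA ler_pM // ?gC // fb // a0 (le_trans akb).
apply: le_lt_trans h2 _.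
have h3 : B * (\sum_(k < n) `|f (b k) - f (a k)|) <= e / 2.
  apply: (@le_trans _ _ ((B + 1) * (e / (2 * (B + 1))))).
    apply: ler_pM => //; [exact: sumr_ge0|lra|exact: ltW].
  by rewrite le_eqVlt; apply/orP; left; apply/eqP; field; rewrite gt_eqF //; lra.
have h4 : A * C * (\sum_(k < n) (b k - a k)) < e / 2.
  have s0 : 0 <= \sum_(k < n) (b k - a k).
    by apply: sumr_ge0 => k _; have [_ h _] := ab k; rewrite subr_ge0.
  apply: (@le_lt_trans _ _ ((A * C + 1) * \sum_(k < n) (b k - a k))).
    by rewrite ler_wpM2r //; lra.
  rewrite (_ : e / 2 = (A * C + 1) * (e / (2 * (A * C + 1)))).
    by rewrite ltr_pM2l //; lra.
  by field; rewrite gt_eqF //; lra.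
lra.
Qed.

End AbsContinuousSum.

Section EnergyBound.
Context {R : realType} {d : nat} {Omega : set 'rV[R]_d} (T : mesh Omega).
Variable theta : T -> T -> R -> R -> R.
Local Notation mu := (@lebesgue_measure R).

Lemma action_dual_ge (m sigma psi : T -> R) :
  ((2 * \sum_(K : T) psi K * sigma K - action theta m psi)%:E <=
   action_dual theta m sigma)%E.
Proof. by apply: ereal_sup_ubound; exists psi. Qed.

Lemma action_dual_ge0 (m sigma : T -> R) : (0 <= action_dual theta m sigma)%E.
Proof.
apply: le_trans (action_dual_ge m sigma (fun=> 0)).
have -> : action theta m (fun=> 0) = 0.
  rewrite /action big1 ?mulr0 // => K _.
  by rewrite big1 // => L _; rewrite subrr expr0n mulr0.
by rewrite big1 ?mulr0 ?subrr // => K _; rewrite mul0r.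
Qed.

(** The competitor in the supremum defining the dual action is [phi t]. With [F t] the sum of
    [m t K * phi t K], the bound by [c] gives [2 * (F' t - c) <= A*(m_t, m_t')] almost everywhere,
    and this is integrated. *)
Lemma curve_energy_ge (m0 m1 : T -> R) (m phi dphi : R -> T -> R) (B C c : R) :
  admissible_curve m0 m1 m ->
  0 <= B -> 0 <= C ->
  (forall t K, 0 <= t <= 1 -> `|phi t K| <= B) ->
  (forall t t' K, 0 <= t -> t <= t' -> t' <= 1 ->
     `|phi t' K - phi t K| <= C * (t' - t)) ->
  (forall (t : R) K, 0 < t < 1 -> is_derive t 1 (fun s => phi s K) (dphi t K)) ->
  (forall t, 0 < t < 1 ->
     \sum_K m t K * dphi t K + 2^-1 * action theta (m t) (phi t) <= c) ->
  ((2 * (\sum_K m1 K * phi 1 K - \sum_K m0 K * phi 0 K - c))%:E <=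
   curve_energy theta m)%E.
Proof.
move=> [mP mA m0E m1E] B0 C0 phiB phiC phid phic.
pose F t := \sum_K m t K * phi t K.
have FA : abs_continuous01 F.
  apply: abs_continuous01_sum => K.
  apply: (@abs_continuous01M_lipschitz _ _ _ 1 B C) => //.
  - move=> t t01; have [mt0 mt1] := mP t t01; rewrite ger0_norm // -mt1.
    by rewrite (bigD1 K) //= lerDl sumr_ge0.
  - by move=> t; exact: phiB.
  - by move=> t t'; exact: phiC.
have [g [ig dF gE]] := abs_continuous_derivable FA.
have dm : {ae mu, forall t : R, forall K : T, 0 < t < 1 -> derivable (fun s => m s K) t 1}.
  apply: (@filter_forall _ _ _ _ (ae_filter_ringOfSetsType mu)).
  move=> K; have [gK [_ dK _]] := abs_continuous_derivable (mA K).
  apply: filterS dK; first exact: (ae_filter_ringOfSetsType mu).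
  by move=> t h /h[].
(* The integral of [g] is over []0, 1]], but derivatives are only known in the open interval. *)
have nt1 : {ae mu, forall t : R, t != 1}.
  exists [set 1]; split; [exact: measurable_set1|exact: lebesgue_measure_set1|].
  by move=> t /= /negP; rewrite negbK => /eqP.
have mI : measurable (`]0%R, 1%R] : set (measurableTypeR R)) by exact: measurable_itv.
have muI : (mu `]0%R, 1%R] = 1)%E by rewrite lebesgue_measure_itv /= lte_fin ltr01 -EFinB subr0.
have ig1 : mu.-integrable `]0%R, 1%R] (EFin \o g) by exact: (integrableS measurableT).
have ic : mu.-integrable `]0%R, 1%R] (EFin \o cst c).
  rewrite (_ : EFin \o cst c = cst c%:E) //.
  apply/integrableP; split; first exact: measurable_cst.
  under eq_integral do rewrite /=.
  by rewrite integral_cst // [X in (_ * X)%E](_ : _ = 1%E) ?mule1 ?ltry.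
have F10 : F 1 = \sum_K m1 K * phi 1 K by apply: eq_bigr => K _; rewrite m1E.
have F00 : F 0 = \sum_K m0 K * phi 0 K by apply: eq_bigr => K _; rewrite m0E.
rewrite -F10 -F00.
have -> : (2 * (F 1 - F 0 - c))%:E = (\int[mu]_(t in `]0%R, 1%R]) (2 * (g t - c))%:E)%E.
  under eq_integral do rewrite EFinM EFinB.
  rewrite integralZl //; last exact: (integrableB mI ig1 ic).
  rewrite integralB // gE integral_cst // [X in (c%:E * X)%E](_ : _ = 1%E) //.
  by rewrite mule1 -EFinB -EFinM.
apply: ae_le_integral_minorant => //.
- by move=> t /=; rewrite !in_itv /= => /andP[/ltW -> ->].
- rewrite (_ : (fun t => _) = (fun t => 2%:E * ((EFin \o g) \- (EFin \o cst c)) t)%E).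
    by apply: integrableZl => //; exact: integrableB.
  by apply/funext => t /=; rewrite -EFinB -EFinM.
- by move=> t _; exact: action_dual_ge0.
have aeF := ae_filter_ringOfSetsType mu.
move: dF dm nt1; apply: filterS3 => t dF dm t1.
rewrite /= in_itv /= => /andP[t0 t1'].
have t01 : 0 < t < 1 by rewrite t0 lt_neqAle t1.
have {dF} [_ Fg] := dF t01.
have Fd : is_derive t 1 F (\sum_K (m t K * dphi t K + phi t K * derive1 (fun s => m s K) t)).
  apply: is_derive_big => K.
  have h1 : is_derive t 1 (fun s => m s K) (derive1 (fun s => m s K) t).
    by rewrite derive1E; apply: DeriveDef => //; exact: dm.
  have h2 := phid t K t01.
  exact: (is_deriveM h1 h2).
have gt : g t = \sum_K (m t K * dphi t K + phi t K * derive1 (fun s => m s K) t).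
  by rewrite -Fg derive1E; exact: derive_val.
apply: le_trans (action_dual_ge _ _ (phi t)).
rewrite lee_fin gt big_split /=; have := phic t t01; lra.
Qed.

End EnergyBound.

(** * Couplings built from a coarse mesh *)

Section Coupling.
Context {R : realType} {d : nat} {Omega : set 'rV[R]_d} (T : mesh Omega) (k0 : T).
Variables (mu0 mu1 : probability (borel R d) R).
Hypotheses (mu0_Omega : mu0 (closure Omega) = 1%E) (mu1_Omega : mu1 (closure Omega) = 1%E).

Lemma measurable_coord (i : 'I_d) :
  measurable_fun setT (fun x : borel R d => (x : 'rV[R]_d) 0 i).
Proof.
apply: (measurability _ (RGenOpens.measurableE R)).
move=> _ [_ [a [b ->] <-]]; rewrite setTI; apply: sub_sigma_algebra.
have /continuousP : continuous (fun x : 'rV[R]_d => x 0 i) by exact: coord_continuous.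
by apply; exact: interval_open.
Qed.

Lemma measurable_sqr_dist :
  measurable_fun setT (fun z : borel R d * borel R d =>
    (enorm (z.1 - z.2 : 'rV[R]_d)) ^+ 2).
Proof.
under eq_fun do rewrite enorm_sqr /edot.
apply: measurable_sum => i; under eq_fun do rewrite !mxE.
have m1 : measurable_fun setT (fun z : borel R d * borel R d => (z.1 : 'rV[R]_d) 0 i).
  exact: (measurableT_comp (measurable_coord i) measurable_fst).
have m2 : measurable_fun setT (fun z : borel R d * borel R d => (z.2 : 'rV[R]_d) 0 i).
  exact: (measurableT_comp (measurable_coord i) measurable_snd).
by apply: measurable_funM; apply: measurable_funB.
Qed.

Lemma probability_cells (mu : probability (borel R d) R) (A : set (borel R d)) :
  mu (closure Omega) = 1%E -> measurable A ->
  \sum_(K : T) mu (A `&` cell T K) = mu A.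
Proof.
move=> mu1E mA.
have mO : measurable (closure Omega : set (borel R d)).
  rewrite -(cell_cover T); apply: fin_bigcup_measurable; first exact: finite_finset.
  by move=> K _; exact: cell_measurable.
have -> : mu A = mu (A `&` closure Omega).
  rewrite (measureDI mu mA mO) addeC -[RHS]adde0; congr (_ + _)%E.
  apply/eqP; rewrite -measure_le0.
  apply: (@le_trans _ _ (mu (~` closure Omega))).
    apply: le_measure; rewrite ?inE; [exact: measurableD|exact: measurableC|by move=> x []].
  by rewrite probability_setC // mu1E subee.
rewrite -(cell_cover T) setI_bigcupr measure_fin_bigcup //.
- rewrite fsbig_seq ?index_enum_uniq //; apply: eq_fsbigl.
  by apply/seteqP; split => // K _ /=; rewrite mem_index_enum.
- exact: finite_finset.
- apply: trivIset_setIl; exact: cell_disjoint.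
- by move=> K _; apply: measurableI => //; exact: cell_measurable.
Qed.
Lemma le_integral_carried {dsp} {X : measurableType dsp} (m : {measure set X -> \bar R})
    (E : set X) (f : X -> \bar R) (c : R) :
  measurable E -> m (~` E) = 0%E -> measurable_fun setT f -> (forall x, 0 <= f x)%E ->
  (forall x, E x -> f x <= c%:E)%E ->
  (\int[m]_x f x <= c%:E * m E)%E.
Proof.
move=> mE mE0 mf f0 fc.
rewrite (ge0_negligible_integral (measurableC mE)) // setTD setCK.
rewrite -integral_cst //; apply: ge0_le_integral_minorant => //.
by move=> x /fc; apply: le_trans.
Qed.

Variable g : T -> T -> R.
Hypotheses (g_ge0 : forall K L, 0 <= g K L)
  (g_fst : forall K, \sum_L g K L = discretize T mu0 K)
  (g_snd : forall L, \sum_K g K L = discretize T mu1 L).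

(** The coupling spreads the mass [g K L] over a pair of cells as the product of the conditional
    measures; [W K L] is its density there with respect to the product of [mu0] and [mu1], equal to
    0 by the division convention if a cell has no mass. *)
Let W (K L : T) : R := g K L / (discretize T mu0 K * discretize T mu1 L).

Let discretize_ge0 (mu : probability (borel R d) R) (K : T) : 0 <= discretize T mu K.
Proof. exact: fine_ge0. Qed.

Let W_ge0 K L : 0 <= W K L.
Proof. by rewrite divr_ge0 // mulr_ge0. Qed.

Let E (p : T * T) : set (borel R d * borel R d) := cell T p.1 `*` cell T p.2.

Let mE p : measurable (E p).
Proof. by apply: measurableX; exact: cell_measurable. Qed.

Let prod_mu : measure _ _ := (mu0 \x mu1)%E.

Let piece p : measure _ _ := mscale (NngNum (W_ge0 p.1 p.2)) (mrestr prod_mu (mE p)).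

Let coupling := msum (fun i => piece (nth (k0, k0) (enum {: T * T}) i)) (size (enum {: T * T})).

Let pieceE p (A B : set (borel R d)) : measurable A -> measurable B ->
  piece p (A `*` B) = ((W p.1 p.2)%:E * (mu0 (A `&` cell T p.1) * mu1 (B `&` cell T p.2)))%E.
Proof.
move=> mA mB; rewrite /piece /= /mscale /= /mrestr -setXI; congr (_ * _)%E.
by apply: product_measure1E; apply: measurableI => //; exact: cell_measurable.
Qed.

Let couplingE A : coupling A = (\sum_(p : T * T) piece p A)%E.
Proof.
rewrite /coupling /msum -(big_mkord xpredT (fun i => piece (nth (k0, k0) (enum {: T * T}) i) A)).
by rewrite -(big_nth (k0, k0) xpredT (fun p => piece p A)) big_enum.
Qed.

(** If the cell [L] has no mass, [g K L] vanishes as a term of a zero sum of nonnegative numbers, so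
    the cancellation also holds under [x / 0 = 0]. *)
Let W_cancel_snd K L : W K L * discretize T mu1 L = g K L / discretize T mu0 K.
Proof.
rewrite /W; have [m0|m0] := eqVneq (discretize T mu1 L) 0; last by rewrite invfM mulrA divfK.
by rewrite (psumr_eq0P (fun K _ => g_ge0 K L) (etrans (g_snd L) m0)) // !mul0r.
Qed.

Let W_cancel_fst K L : W K L * discretize T mu0 K = g K L / discretize T mu1 L.
Proof.
rewrite /W; have [m0|m0] := eqVneq (discretize T mu0 K) 0; last first.
  by rewrite [X in g K L / X]mulrC invfM mulrA divfK.
by rewrite (psumr_eq0P (fun L _ => g_ge0 K L) (etrans (g_fst K) m0)) // !mul0r.
Qed.

Let coupling_fst A : measurable A -> coupling (A `*` setT) = mu0 A.
Proof.
move=> mA; rewrite couplingE -(probability_cells mu0_Omega mA).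
under eq_bigr do rewrite pieceE // setTI.
rewrite -(pair_bigA _ (fun K L => (W K L)%:E * (mu0 (A `&` cell T K) * mu1 (cell T L)))%E) /=.
apply: eq_bigr => K _.
have mAK : measurable (A `&` cell T K : set (borel R d)).
  by apply: measurableI => //; exact: cell_measurable.
have aE : mu0 (A `&` cell T K) = (fine (mu0 (A `&` cell T K)))%:E.
  by rewrite fineK // fin_num_measure.
rewrite aE; set a := fine _.
have a0 : 0 <= a by exact: fine_ge0.
have am : a <= discretize T mu0 K.
  apply: fine_le; rewrite ?fin_num_measure //; first exact: cell_measurable.
  by apply: le_measure; rewrite ?inE //; exact: cell_measurable.
rewrite (eq_bigr (fun L => (a * (g K L / discretize T mu0 K))%:E)).
  rewrite sumEFin -mulr_sumr -mulr_suml g_fst; congr (_%:E).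
  have [m0|m0] := eqVneq (discretize T mu0 K) 0; last by rewrite divff // mulr1.
  by apply/eqP; rewrite m0 mul0r mulr0 eq_le a0 -m0.
move=> L _; rewrite -W_cancel_snd.
rewrite (_ : mu1 (cell T L) = (discretize T mu1 L)%:E); last first.
  by rewrite fineK // fin_num_measure //; exact: cell_measurable.
by rewrite -!EFinM; congr (_%:E); ring.
Qed.

Let coupling_snd A : measurable A -> coupling (setT `*` A) = mu1 A.
Proof.
move=> mA; rewrite couplingE -(probability_cells mu1_Omega mA).
under eq_bigr do rewrite pieceE // setTI.
rewrite -(pair_bigA _ (fun K L => (W K L)%:E * (mu0 (cell T K) * mu1 (A `&` cell T L)))%E) /=.
rewrite exchange_big; apply: eq_bigr => L _ /=.
have mAL : measurable (A `&` cell T L : set (borel R d)).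
  by apply: measurableI => //; exact: cell_measurable.
have aE : mu1 (A `&` cell T L) = (fine (mu1 (A `&` cell T L)))%:E.
  by rewrite fineK // fin_num_measure.
rewrite aE; set a := fine _.
have a0 : 0 <= a by exact: fine_ge0.
have am : a <= discretize T mu1 L.
  apply: fine_le; rewrite ?fin_num_measure //; first exact: cell_measurable.
  by apply: le_measure; rewrite ?inE //; exact: cell_measurable.
rewrite (eq_bigr (fun K => (a * (g K L / discretize T mu1 L))%:E)).
  rewrite sumEFin -mulr_sumr -mulr_suml g_snd; congr (_%:E).
  have [m0|m0] := eqVneq (discretize T mu1 L) 0; last by rewrite divff // mulr1.
  by apply/eqP; rewrite m0 mul0r mulr0 eq_le a0 -m0.
move=> K _; rewrite -W_cancel_fst.
rewrite (_ : mu0 (cell T K) = (discretize T mu0 K)%:E); last first.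
  by rewrite fineK // fin_num_measure //; exact: cell_measurable.
by rewrite -!EFinM; congr (_%:E); ring.
Qed.

Let coupling_setT : coupling setT = 1%E.
Proof. by rewrite -setXTT coupling_fst // probability_setT. Qed.

HB.instance Definition _ := Measure.on coupling.
HB.instance Definition _ := Measure_isProbability.Build _ _ _ coupling coupling_setT.

(** The coupling puts mass at most [g K L] on the product of the cells [K] and [L], where the
    squared distance is at most [c K L]. *)
Lemma W2_cost_le (c : T -> T -> R) :
  (forall K L x y, cell T K x -> cell T L y -> enorm (x - y) ^+ 2 <= c K L) ->
  (ereal_inf [set (\int[gamma]_(z in setT)
                           ((enorm (z.1 - z.2 : 'rV[R]_d)) ^+ 2)%:E)%E
          | gamma in [set gamma | is_coupling mu0 mu1 gamma]] <=
   (\sum_K \sum_L g K L * c K L)%:E)%E.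
Proof.
move=> cP.
apply: le_trans (ereal_inf_lbound _) _.
  exists (coupling : probability _ _); last reflexivity.
  by move=> A mA; split; [exact: coupling_fst|exact: coupling_snd].
have mf : measurable_fun setT (fun z : borel R d * borel R d =>
    ((enorm (z.1 - z.2 : 'rV[R]_d)) ^+ 2)%:E).
  by apply/measurable_EFinP; exact: measurable_sqr_dist.
rewrite /coupling ge0_integral_measure_sum //; last by move=> z _; rewrite lee_fin sqr_ge0.
rewrite -(big_mkord xpredT (fun i => (\int[piece (nth (k0, k0) (enum {: T * T}) i)]_z
  ((enorm (z.1 - z.2 : 'rV[R]_d)) ^+ 2)%:E)%E)).
rewrite -(big_nth (k0, k0) xpredT (fun p => (\int[piece p]_z
  ((enorm (z.1 - z.2 : 'rV[R]_d)) ^+ 2)%:E)%E)) big_enum pair_big -sumEFin /=.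
apply: lee_sum => p _.
have h : (piece p (E p) <= (g p.1 p.2)%:E)%E.
  rewrite pieceE; [|exact: cell_measurable..]; rewrite !setIid.
  rewrite (_ : mu0 (cell T p.1) = (discretize T mu0 p.1)%:E); last first.
    by rewrite fineK // fin_num_measure //; exact: cell_measurable.
  rewrite (_ : mu1 (cell T p.2) = (discretize T mu1 p.2)%:E); last first.
    by rewrite fineK // fin_num_measure //; exact: cell_measurable.
  rewrite -!EFinM lee_fin mulrA W_cancel_fst.
  have [->|m0] := eqVneq (discretize T mu1 p.2) 0; first by rewrite invr0 !mulr0.
  by rewrite divfK.
(* Cells have points, so [c] dominates a square; the sign is needed to multiply the mass bound by
   [c]. *)
have c0 : (0 <= c p.1 p.2).
  have [x /interior_subset xK] := cell_interior_nonempty (m := T) p.1.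
  have [y /interior_subset yL] := cell_interior_nonempty (m := T) p.2.
  exact: le_trans (sqr_ge0 _) (cP _ _ _ _ xK yL).
apply: (@le_trans _ _ ((c p.1 p.2)%:E * piece p (E p))%E).
  apply: le_integral_carried => //.
  - by rewrite /piece /= /mscale /= /mrestr setICl measure0 mule0.
  - by move=> z; rewrite lee_fin sqr_ge0.
  - by move=> z [z1 z2]; rewrite lee_fin; exact: cP.
by rewrite mulrC EFinM lee_wpmul2l ?lee_fin.
Qed.

End Coupling.

(** * Distances and discretisation on meshes *)

Section Geometry.
Context {R : realType} {d : nat}.
Implicit Types (x y : 'rV[R]_d) (A : set 'rV[R]_d).

Lemma enorm_le_norm x : enorm x <= d%:R * `|x|.
Proof.
rewrite -ler_sqr ?nnegrE ?enorm_ge0 ?mulr_ge0 // enorm_sqr.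
apply: (@le_trans _ _ (\sum_(i < d) `|x| ^+ 2)).
  apply: ler_sum => i _; rewrite -expr2 -real_normK ?num_real // ler_sqr ?nnegrE //.
  rewrite {2}/Num.norm /= mx_normrE.
  exact: (le_bigmax _ (fun ij => `|x ij.1 ij.2|) (0, i)).
rewrite sumr_const card_ord -[leLHS]mulr_natl exprMn ler_wpM2r ?sqr_ge0 //.
rewrite -natrX ler_nat; case: (d) => // n; by rewrite expnS expn1 leq_pmull.
Qed.

Lemma closure_enorm A x : closure A x -> forall e : R, 0 < e -> exists2 a, A a & enorm (x - a) < e.
Proof.
move=> Ax e e0; have dp : 0 < (d.+1)%:R :> R by rewrite ltr0n.
have [a [Aa xa]] := Ax _ (nbhsx_ballx x _ (divr_gt0 e0 dp)).
exists a => //; apply: le_lt_trans (enorm_le_norm _) _.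
move: xa; rewrite -ball_normE /= => xa.
apply: (@le_lt_trans _ _ (d.+1%:R * `|x - a|)); first by rewrite ler_wpM2r // ler_nat.
by rewrite mulrC -ltr_pdivlMr.
Qed.

Lemma closure_dist_le A (D : R) :
  (forall x y, A x -> A y -> enorm (x - y) <= D) ->
  forall x y, closure A x -> closure A y -> enorm (x - y) <= D.
Proof.
move=> AD x y Ax Ay; apply/ler_addgt0Pr => e e0.
have e2 : 0 < e / 2 by rewrite divr_gt0.
have [a Aa xa] := closure_enorm Ax e2; have [b Ab yb] := closure_enorm Ay e2.
have := enorm_triangle a x y; have := enorm_triangle b a y; rewrite (enormB b y).
by have := AD a b Aa Ab; lra.
Qed.

Lemma bounded_dist A : bounded_set A ->
  exists2 D : R, 0 < D & forall x y, A x -> A y -> enorm (x - y) <= D.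
Proof.
move=> [M [_ /(_ (`|M| + 1))]]; rewrite (le_lt_trans (ler_norm _)) ?ltrDl // => /(_ isT) AM.
exists (d.+1%:R * (2 * (`|M| + 1))).
  by rewrite mulr_gt0 ?ltr0n // mulr_gt0 // ltr_wpDl.
move=> x y Ax Ay; apply: le_trans (enorm_le_norm _) _.
apply: ler_pM => //; first by rewrite ler_nat.
apply: le_trans (ler_normB _ _) _; have := AM _ Ax; have := AM _ Ay => /=; lra.
Qed.

(** Used contrapositively: a face of positive measure contains a point, which links the cells of two
    neighbours. *)
Lemma hausdorff_set0_le n : (hausdorff n (@set0 'rV[R]_d) <= 0)%E.
Proof.
apply: ge_ereal_sup => _ [e e0 <-]; apply: ereal_inf_lbound.
exists (fun=> set0); first by split=> // k x y [].
by apply: eseries0 => k _ _; rewrite /hausdorff_size; case: asboolP => // -[x []].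
Qed.

End Geometry.

Section MeshGeometry.
Context {R : realType} {d : nat} {Omega : set 'rV[R]_d} (D : R).
Hypothesis (Omega_dist : forall x y, Omega x -> Omega y -> enorm (x - y) <= D).
Implicit Types T : mesh Omega.

Lemma closure_Omega_dist x y : closure Omega x -> closure Omega y -> enorm (x - y) <= D.
Proof. exact: closure_dist_le. Qed.

Lemma cell_closure T (K : T) x : cell T K x -> closure Omega x.
Proof. by move=> Kx; rewrite -(cell_cover T); exists K. Qed.

Lemma mesh_size_ge0 T : 0 <= mesh_size T.
Proof. by rewrite /mesh_size; exact: bigmax_ge_id. Qed.

Lemma cell_dist T (K : T) x y : closure (cell T K) x -> closure (cell T K) y ->
  enorm (x - y) <= mesh_size T.
Proof.
apply: closure_dist_le => {}x {}y Kx Ky.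
apply: (@le_trans _ _ (diam (cell T K))).
  apply: ub_le_sup; last by exists x => //; exists y.
  exists D => _ [a Ka [b Kb <-]].
  exact: (closure_Omega_dist (cell_closure Ka) (cell_closure Kb)).
exact: (le_bigmax _ (fun K => diam (cell T K)) K).
Qed.

Lemma nbr_dist T (K L : T) : nbr K L -> enorm (pt T K - pt T L) <= 2 * mesh_size T.
Proof.
move=> /andP[_]; rewrite /face_measure.
have [->|/set0P[z [zK zL]] _] := eqVneq (face K L) set0; first by rewrite ltNge hausdorff_set0_le.
have := enorm_triangle z (pt T K) (pt T L).
have := cell_dist (@pt_in_cell _ _ _ T K) zK; have := cell_dist zL (@pt_in_cell _ _ _ T L); lra.
Qed.

Lemma cell_pair_dist T (K L : T) x y : cell T K x -> cell T L y ->
  enorm (x - y) <= enorm (pt T K - pt T L) + 2 * mesh_size T.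
Proof.
move=> /subset_closure Kx /subset_closure Ly.
have := enorm_triangle (pt T K) x y; have := enorm_triangle (pt T L) (pt T K) y.
have := cell_dist Kx (@pt_in_cell _ _ _ T K); have := cell_dist (@pt_in_cell _ _ _ T L) Ly; lra.
Qed.

Lemma discretize_probability T (mu : probability (borel R d) R) :
  mu (closure Omega) = 1%E -> discrete_probability (discretize T mu).
Proof.
move=> muE; split; first by move=> K; exact: fine_ge0.
have := probability_cells T muE measurableT; rewrite probability_setT.
rewrite (eq_bigr (fun K => (discretize T mu K)%:E)); first by rewrite sumEFin => -[].
by move=> K _; rewrite setTI fineK // fin_num_measure //; exact: cell_measurable.
Qed.

(** Both sums are refined to the intersections of cells of [T1] and [T2]. An empty intersection has
    no mass; a nonempty one has a point within [mesh_size T1] of [x_K] and within [mesh_size T2] of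
    [x_L]. *)
Lemma discretize_compare T1 T2 (mu : probability (borel R d) R) (f : 'rV[R]_d -> R) (C : R) :
  mu (closure Omega) = 1%E ->
  (forall x y, closure Omega x -> closure Omega y -> `|f x - f y| <= C * enorm (x - y)) ->
  0 <= C ->
  \sum_(K : T1) discretize T1 mu K * f (pt T1 K) -
  \sum_(L : T2) discretize T2 mu L * f (pt T2 L) <= C * (mesh_size T1 + mesh_size T2).
Proof.
move=> muE fC C0.
pose w (K : T1) (L : T2) := fine (mu (cell T1 K `&` cell T2 L)).
have mKL (K : T1) (L : T2) : measurable (cell T1 K `&` cell T2 L : set (borel R d)).
  by apply: measurableI; exact: cell_measurable.
have w1 K : \sum_L w K L = discretize T1 mu K.
  have := probability_cells T2 muE (cell_measurable (m := T1) K).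
  rewrite (eq_bigr (fun L => (w K L)%:E)) ?sumEFin => [h|L _]; first by rewrite /discretize -h.
  by rewrite fineK // fin_num_measure.
have w2 L : \sum_K w K L = discretize T2 mu L.
  have := probability_cells T1 muE (cell_measurable (m := T2) L).
  rewrite (eq_bigr (fun K => (w K L)%:E)) ?sumEFin => [h|K _]; first by rewrite /discretize -h.
  by rewrite setIC fineK // fin_num_measure.
have w0 K L : 0 <= w K L by exact: fine_ge0.
have wsum : \sum_K \sum_L w K L = 1.
  under eq_bigr do rewrite w1.
  by have [] := discretize_probability T1 muE.
rewrite (eq_bigr (fun K => \sum_L w K L * f (pt T1 K))); last first.
  by move=> K _; rewrite -mulr_suml w1.
rewrite [X in _ - X](eq_bigr (fun L => \sum_K w K L * f (pt T2 L))); last first.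
  by move=> L _; rewrite -mulr_suml w2.
rewrite [X in _ - X]exchange_big -sumrB -[leRHS]mul1r -wsum mulr_suml /=.
apply: ler_sum => K _; rewrite mulr_suml -sumrB; apply: ler_sum => L _.
rewrite -mulrBr.
have [E0|/set0P[z [Kz Lz]]] := eqVneq (cell T1 K `&` cell T2 L) set0.
  by rewrite /w E0 measure0 !mul0r.
rewrite ler_wpM2l //; apply: le_trans (ler_norm _) _.
apply: le_trans (fC _ _ (@pt_in_domain _ _ _ T1 K) (@pt_in_domain _ _ _ T2 L)) _; rewrite ler_wpM2l //.
have := enorm_triangle z (pt T1 K) (pt T2 L).
have := cell_dist (@pt_in_cell _ _ _ T1 K) (subset_closure Kz).
have := cell_dist (subset_closure Lz) (@pt_in_cell _ _ _ T2 L); lra.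
Qed.

Lemma mesh_inhabited T (mu : probability (borel R d) R) :
  mu (closure Omega) = 1%E -> exists K : T, True.
Proof.
move=> muE; have [_ m1] := discretize_probability T muE.
have [T0|/card_gt0P[K _]] := posnP #|T|; last by exists K.
move: m1; rewrite big1 => [/eqP|K]; first by rewrite eq_sym oner_eq0.
by have := card0_eq T0 K.
Qed.

End MeshGeometry.

(** * Lower bound *)

Section LowerBound.
Context {R : realType} {d : nat} {Omega : set 'rV[R]_d} (D : R).
Hypotheses (D_gt0 : 0 < D)
  (Omega_dist : forall x y, Omega x -> Omega y -> enorm (x - y) <= D).

Let D_ge0 : 0 <= D. Proof. exact: ltW. Qed.

Let pts_dist (T1 T2 : mesh Omega) (K : T1) (L : T2) : enorm (pt T1 K - pt T2 L) <= D.
Proof.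
exact: (closure_Omega_dist Omega_dist (@pt_in_domain _ _ _ T1 K) (@pt_in_domain _ _ _ T2 L)).
Qed.

Section Test.
Variables (T0 : mesh Omega) (k0 : T0) (s e : R).
Hypotheses (s_gt0 : 0 < s) (e_gt0 : 0 < e).

Local Notation u phi := (hj (pt T0) phi s e).

(** On each cell the quantity to bound is [- S / 2 + (1 + eta) * (P + om * d) / 2] with
    [P <= S <= (D / s) ^+ 2]. The subsolution property [P <= S] removes the main terms, and
    [|eta| <= etab <= 1] leaves [etab * (D / s) ^+ 2 / 2 + om * d]. *)
Lemma curve_energy_hj (T : mesh Omega) (theta : T -> T -> R -> R -> R)
    (lambda : T -> T -> R) (eta : T -> R) (m0 m1 : T -> R) (m : R -> T -> R)
    (phi : T0 -> R) (r om etab : R) :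
  mean_function theta -> weight_function lambda -> compatible theta lambda ->
  (forall K, loewner_le (isotropy_mx lambda K) ((cell_vol K * (1 + eta K))%:M)) ->
  (forall K, `|eta K| <= etab) -> etab <= 1 ->
  2 * mesh_size T <= r -> r <= D -> 3 * D * r <= s * e ->
  2 * (D / s) * hj_const D s e * r + hj_const D s e ^+ 2 * r ^+ 2 <= om ->
  admissible_curve m0 m1 m ->
  ((2 * (\sum_K m1 K * u phi 1 (pt T K) - \sum_K m0 K * u phi 0 (pt T K) -
     2^-1 * (etab * (D / s) ^+ 2 + 2 * om * d%:R)))%:E <= curve_energy theta m)%E.
Proof.
move=> th_mean lam_w th_comp iso etaP etab1 mr rD rse omP mC.
have s0 : 0 <= s by exact: ltW.
have pD (K : T) : forall k, enorm (pt T K - pt T0 k) <= D by move=> k; exact: pts_dist.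
have Ds0 : 0 <= (D / s) ^+ 2 by exact: sqr_ge0.
have r0 : 0 <= r by apply: le_trans mr; rewrite mulr_ge0 // mesh_size_ge0.
have C0 := hj_const_ge0 e_gt0 s_gt0 D_ge0.
have om0 : 0 <= om.
  by apply: le_trans omP; rewrite addr_ge0 ?mulr_ge0 ?invr_ge0 ?sqr_ge0.
have uT (t t' : R) K : 0 <= t -> t <= t' ->
    `|u phi t (pt T K) - u phi t' (pt T K)| <= (D / s) ^+ 2 * (t' - t).
  by move=> t0 tt'; apply: hj_time_lipschitz.
pose B := (D / s) ^+ 2 + \sum_K `|u phi 0 (pt T K)|.
have := (@curve_energy_ge _ _ _ _ _ m0 m1 m (fun t K => u phi t (pt T K))
  (fun t K => - hj_speed (pt T0) phi s e t (pt T K) / 2) B ((D / s) ^+ 2)); apply => //.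
- by rewrite addr_ge0 ?sumr_ge0.
- move=> t K /andP[t0 t1].
  have h1 := uT 0 t K (lexx 0) t0.
  have h2 : `|u phi 0 (pt T K)| <= \sum_K `|u phi 0 (pt T K)|.
    by rewrite [leRHS](bigD1 K) //= lerDl sumr_ge0.
  have h3 : (D / s) ^+ 2 * (t - 0) <= (D / s) ^+ 2 by rewrite subr0 ler_piMr.
  rewrite /B -(subrK (u phi 0 (pt T K)) (u phi t (pt T K))).
  apply: le_trans (ler_normD _ _) _; rewrite distrC; lra.
- by move=> t t' K t0 tt' _; rewrite distrC; exact: uT.
- by move=> t K /andP[/ltW t0 _]; exact: is_derive_hj.
move=> t /andP[/ltW t0 /ltW t1].
have [mt0 mt1] : discrete_probability (m t) by have [mP _ _ _] := mC; apply: mP; rewrite t0.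
have eta0 K : 0 <= 1 + eta K by have /ler_normlP[] := etaP K; lra.
pose p K := hj_grad (pt T0) phi s e t (pt T K).
have inc (K L : T) : nbr K L -> (u phi t (pt T K) - u phi t (pt T L)) ^+ 2 <=
    edot (p K) (pt T K - pt T L) ^+ 2 + om * enorm (pt T K - pt T L) ^+ 2.
  move=> KL.
  have hr : enorm (pt T L - pt T K) <= r.
    by rewrite enormB; apply: le_trans (nbr_dist Omega_dist KL) mr.
  rewrite -sqrrN opprB -(opprB (pt T L)) edotNr sqrrN enormN.
  apply: le_trans (hj_increment k0 phi e_gt0 s_gt0 D_ge0 t0 (pD K) _ _ hr) _.
  - exact: pts_dist.
  - by apply: le_trans rse; rewrite ler_wpM2l // mulr_ge0.
  - by rewrite lerD2l ler_wpM2r ?sqr_ge0.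
have /(ler_wpM2l (_ : 0 <= 2^-1)) := action_le th_mean lam_w th_comp iso mt0 eta0 om0 inc.
rewrite invr_ge0 => /(_ (ler0n _ _)) act.
apply: le_trans (lerD (lexx _) act) _.
rewrite mulr_sumr -big_split /= -[leRHS]mul1r -[X in _ <= X * _]mt1 mulr_suml.
apply: ler_sum => K _.
rewrite [2^-1 * (m t K * _)]mulrCA -mulrDr ler_wpM2l //.
have g1 := hj_grad_speed k0 (pt T0) phi s e t (pt T K); rewrite -/(p K) in g1.
have sp0 := hj_speed_ge0 k0 (pt T0) phi s e t (pt T K).
have sp1 := hj_speed_le k0 phi e_gt0 s_gt0 D_ge0 t0 (pD K).
set S := hj_speed _ _ _ _ _ _ in g1 sp0 sp1 *; set P := edot _ _ in g1 *.
have /ler_normlP[e1 e2] := etaP K.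
have etab0 : 0 <= etab by exact: le_trans (normr_ge0 _) (etaP K).
have h1 : (1 + eta K) * P <= (1 + eta K) * S by rewrite ler_wpM2l.
have h2 : eta K * S <= etab * (D / s) ^+ 2.
  by apply: le_trans (ler_wpM2r sp0 e2) _; rewrite ler_wpM2l.
have omd0 : 0 <= om * d%:R by rewrite mulr_ge0.
have h3 : (1 + eta K) * (om * d%:R) <= 2 * (om * d%:R) by rewrite ler_wpM2r //; lra.
by rewrite mulrDr; lra.
Qed.

(** By the dual constraint, every cost at time 1 and [y_L] is at least [psi L / (1 + s)]; [e * ln N]
    is the gap between the soft and the true minimum. Transferring from the points of [T0] to those
    of [T], at time 0 and at time 1, costs [D / s * (mesh_size T0 + mesh_size T)] each. *)
Lemma dual_le_hj (T : mesh Omega) (mu0 mu1 : probability (borel R d) R) (phi psi : T0 -> R) :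
  mu0 (closure Omega) = 1%E -> mu1 (closure Omega) = 1%E ->
  (forall K L, psi L - phi K <= 2^-1 * enorm (pt T0 K - pt T0 L) ^+ 2) ->
  \sum_L psi L * discretize T0 mu1 L - \sum_K phi K * discretize T0 mu0 K <=
  (1 + s) * (\sum_K discretize T mu1 K * u (fun K => phi K / (1 + s)) 1 (pt T K) -
             \sum_K discretize T mu0 K * u (fun K => phi K / (1 + s)) 0 (pt T K) +
             e * ln #|T0|%:R + 2 * (D / s * (mesh_size T0 + mesh_size T))).
Proof.
move=> mu0E mu1E feas; set v := u _.
have s1 : 0 < 1 + s by rewrite ltr_wpDr // ltW.
have [m00 m01] := discretize_probability T0 mu0E.
have [m10 m11] := discretize_probability T0 mu1E.
have v1 L : psi L / (1 + s) - e * ln #|T0|%:R <= v 1 (pt T0 L).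
  apply: hj_ge => // K; rewrite /hj_cost ler_pdivrMr // -enorm_sqr.
  rewrite mulrDl divfK ?gt_eqF //.
  have -> : enorm (pt T0 L - pt T0 K) ^+ 2 / (2 * (s + 1)) * (1 + s) =
      2^-1 * enorm (pt T0 K - pt T0 L) ^+ 2.
    by rewrite (enormB (pt T0 L)); field; rewrite addrC gt_eqF.
  by have := feas K L; lra.
have v0 K : v 0 (pt T0 K) <= phi K / (1 + s) by apply: hj0_le.
have lip (t : R) : 0 <= t -> forall x y, closure Omega x -> closure Omega y ->
    `|v t x - v t y| <= D / s * enorm (x - y).
  move=> t0 x y xO yO; apply: hj_lipschitz => // k.
    exact: (closure_Omega_dist Omega_dist xO (@pt_in_domain _ _ _ T0 k)).
  exact: (closure_Omega_dist Omega_dist yO (@pt_in_domain _ _ _ T0 k)).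
have Ds0 : 0 <= D / s by rewrite divr_ge0 // ltW.
have c1 := discretize_compare Omega_dist T0 T mu1E (lip 1 ler01) Ds0.
have c0 := discretize_compare Omega_dist T T0 mu0E (lip 0 (lexx 0)) Ds0.
have a1 : (1 + s)^-1 * (\sum_L psi L * discretize T0 mu1 L) - e * ln #|T0|%:R <=
    \sum_L discretize T0 mu1 L * v 1 (pt T0 L).
  rewrite -[X in _ - X]mulr1 -[X in _ - _ * X]m11 !mulr_sumr -sumrB; apply: ler_sum => L _.
  have := ler_wpM2l (m10 L) (v1 L); rewrite mulrBr; lra.
have a0 : \sum_K discretize T0 mu0 K * v 0 (pt T0 K) <=
    (1 + s)^-1 * (\sum_K phi K * discretize T0 mu0 K).
  rewrite mulr_sumr; apply: ler_sum => K _.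
  have := ler_wpM2l (m00 K) (v0 K); lra.
rewrite -ler_pdivrMl // mulrBr; rewrite [mesh_size T + _]addrC in c0; lra.
Qed.

End Test.
End LowerBound.

(** * Squared distance against energy, and choice of the parameters *)

Section Assembly.
Context {R : realType} {d : nat} {Omega : set 'rV[R]_d}.
Variables (mu0 mu1 : probability (borel R d) R).
Hypotheses (mu0_Omega : mu0 (closure Omega) = 1%E) (mu1_Omega : mu1 (closure Omega) = 1%E).

Definition W2_sqr (nu0 nu1 : probability (borel R d) R) : \bar R :=
  ereal_inf [set (\int[gamma]_(z in setT)
                           ((enorm (z.1 - z.2 : 'rV[R]_d)) ^+ 2)%:E)%E
          | gamma in [set gamma | is_coupling nu0 nu1 gamma]].

Lemma W2_sqr_ge0 : (0 <= W2_sqr mu0 mu1)%E.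
Proof.
apply: le_ereal_inf_tmp => _ [gamma _ <-]; apply: integral_ge0 => z _.
by rewrite lee_fin sqr_ge0.
Qed.

Section Coarse.
Variables (D : R) (T0 : mesh Omega) (k0 : T0).
Hypotheses (D_gt0 : 0 < D)
  (Omega_dist : forall x y, Omega x -> Omega y -> enorm (x - y) <= D).

(** The product of the discretised measures serves as plan. The bound makes [W2_sqr] finite and
    settles curves of energy at least [D ^+ 2]. *)
Lemma W2_sqr_le_diam : (W2_sqr mu0 mu1 <= (D ^+ 2)%:E)%E.
Proof.
have [m00 m01] := discretize_probability T0 mu0_Omega.
have [m10 m11] := discretize_probability T0 mu1_Omega.
have gsum K : \sum_L discretize T0 mu0 K * discretize T0 mu1 L = discretize T0 mu0 K.
  by rewrite -mulr_sumr m11 mulr1.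
apply: le_trans (W2_cost_le k0 mu0_Omega mu1_Omega
  (g := fun K L => discretize T0 mu0 K * discretize T0 mu1 L) _ _ _ (c := fun _ _ => D ^+ 2) _) _.
- by move=> K L; rewrite mulr_ge0.
- exact: gsum.
- by move=> L; rewrite -mulr_suml m01 mul1r.
- move=> K L x y Kx Ly; rewrite ler_sqr ?nnegrE ?enorm_ge0 ?(ltW D_gt0) //.
  exact: (closure_Omega_dist Omega_dist (cell_closure Kx) (cell_closure Ly)).
- rewrite lee_fin; under eq_bigr do rewrite -mulr_suml gsum.
  by rewrite -mulr_suml m01 mul1r.
Qed.

(** [v] bounds the discrete transport cost for half the squared distance, whence the factor 2.
    Passing from mesh points to arbitrary points of their cells replaces [n ^+ 2] by
    [(n + 2 * h) ^+ 2], with [n <= D]. *)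
Lemma W2_sqr_le_dual (v : R) :
  (forall phi psi : T0 -> R,
    (forall K L, psi L - phi K <= 2^-1 * enorm (pt T0 K - pt T0 L) ^+ 2) ->
    \sum_L psi L * discretize T0 mu1 L - \sum_K phi K * discretize T0 mu0 K <= v) ->
  (W2_sqr mu0 mu1 <= (2 * v + 4 * D * mesh_size T0 + 4 * mesh_size T0 ^+ 2)%:E)%E.
Proof.
move=> dual; set h := mesh_size T0; have h0 : 0 <= h by exact: mesh_size_ge0.
have [m00 m01] := discretize_probability T0 mu0_Omega.
have [m10 m11] := discretize_probability T0 mu1_Omega.
have [g [g0 g1 g2 gv]] := transport_duality m00 m01 m10 m11 dual.
apply: le_trans (W2_cost_le k0 mu0_Omega mu1_Omega g0 g1 g2
  (c := fun K L => (enorm (pt T0 K - pt T0 L) + 2 * h) ^+ 2) _) _.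
  move=> K L x y Kx Ly; rewrite ler_sqr ?nnegrE ?addr_ge0 ?enorm_ge0 ?mulr_ge0 //.
  exact: (cell_pair_dist Omega_dist Kx Ly).
rewrite lee_fin.
apply: (@le_trans _ _ (\sum_K \sum_L (2 * (g K L * (2^-1 * enorm (pt T0 K - pt T0 L) ^+ 2)) +
    g K L * (4 * D * h + 4 * h ^+ 2)))).
  apply: ler_sum => K _; apply: ler_sum => L _.
  have := closure_Omega_dist Omega_dist (@pt_in_domain _ _ _ T0 K) (@pt_in_domain _ _ _ T0 L).
  set n := enorm _ => nD.
  rewrite (_ : 2 * _ + _ = g K L * (n ^+ 2 + 4 * D * h + 4 * h ^+ 2)); last by field.
  rewrite ler_wpM2l //.
  have : n * h <= D * h by rewrite ler_wpM2r.
  rewrite !expr2; lra.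
under eq_bigr do rewrite big_split /= -mulr_sumr -mulr_suml g1.
rewrite big_split /= -mulr_sumr -mulr_suml m01 mul1r; lra.
Qed.

End Coarse.

(** Seven errors are made at most [del / 8] each: those of [s], of the cells of the coarse mesh in
    the cost, of [etab], [om] and [e], and of the two mesh sizes in [slack]. No parameter depends on
    the curve. *)
Lemma W2_sqr_le_energy (Omega_bounded : bounded_set Omega)
  (I : Type) (T : I -> mesh Omega)
  (T_small : forall h : R, 0 < h -> exists i, mesh_size (T i) <= h)
  (lambda : forall i, T i -> T i -> R)
  (lambda_weight : forall i, weight_function (lambda i))
  (T_isotropic : asymptotically_isotropic T lambda)
  (theta : forall i, T i -> T i -> R -> R -> R)
  (theta_mean : forall i, mean_function (theta i))
  (theta_compatible : forall i, compatible (theta i) (lambda i)) (del : R) :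
  0 < del -> exists2 h : R, 0 < h & forall i, mesh_size (T i) <= h ->
    forall m, admissible_curve (discretize (T i) mu0) (discretize (T i) mu1) m ->
    (W2_sqr mu0 mu1 <= curve_energy (theta i) m + del%:E)%E.
Proof.
move=> del0; have [D D0 Omega_dist] := bounded_dist Omega_bounded.
pose s := Num.min 1 (del / (8 * D ^+ 2)).
have s0 : 0 < s by rewrite lt_min ltr01 divr_gt0 // mulr_gt0 // exprn_gt0.
have s1 : s <= 1 by rewrite ge_min lexx.
have sD : s * D ^+ 2 <= del / 8.
  have : s <= del / (8 * D ^+ 2) by rewrite ge_min lexx orbT.
  by rewrite ler_pdivlMr ?mulr_gt0 ?exprn_gt0 //; lra.
(* [q] bounds both mesh sizes, so that the Lipschitz constant [D / s] times either of them is at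
   most [del / 64]. *)
pose q := del * s / (64 * D).
have q0 : 0 < q by rewrite divr_gt0 // mulr_gt0.
have qE : 8 * (D / s * q) = del / 8 by rewrite /q; field; rewrite !gt_eqF.
have Ds : 0 < D / s by rewrite divr_gt0.
pose h0 := Num.min 1 (Num.min (del / (8 * (4 * D + 4))) q).
have D4 : 0 < 4 * D + 4 by lra.
have h00 : 0 < h0 by rewrite !lt_min ltr01 q0 andbT /= divr_gt0 // mulr_gt0.
have [i0 hi0] := T_small _ h00.
pose T0 := T i0; have [k0 _] := mesh_inhabited T0 mu0_Omega.
pose h' := mesh_size T0; have h'0 : 0 <= h' by exact: mesh_size_ge0.
have h'1 : h' <= 1 by apply: le_trans hi0 _; rewrite ge_min lexx.
have h'D : 4 * D * h' + 4 * h' ^+ 2 <= del / 8.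
  have : h' <= del / (8 * (4 * D + 4)).
    by apply: le_trans hi0 _; rewrite ge_min; apply/orP; right; rewrite ge_min lexx.
  have : h' ^+ 2 <= h' by rewrite expr2 ler_piMl.
  by rewrite ler_pdivlMr ?mulr_gt0 //; lra.
have h'q : h' <= q.
  by apply: le_trans hi0 _; rewrite ge_min; apply/orP; right; rewrite ge_min lexx orbT.
have lnN : 0 <= ln (#|T0|%:R : R).
  by apply: ln_ge0; rewrite ler1n; apply/card_gt0P; exists k0.
pose e := del / (32 * (ln (#|T0|%:R : R) + 1)).
have e0 : 0 < e by rewrite divr_gt0 // mulr_gt0 // ltr_wpDl.
have eN : 4 * (e * ln #|T0|%:R) <= del / 8.
  rewrite (_ : del / 8 = 4 * (e * (ln #|T0|%:R + 1))).
    by rewrite ler_pM2l // ler_wpM2l ?(ltW e0) //; lra.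
  by rewrite /e; field; rewrite gt_eqF // ltr_wpDl.
pose etab := Num.min 1 (del / (16 * (D / s) ^+ 2)).
have etab0 : 0 < etab by rewrite lt_min ltr01 divr_gt0 // mulr_gt0 // exprn_gt0.
have etab1 : etab <= 1 by rewrite ge_min lexx.
have etabE : 2 * (etab * (D / s) ^+ 2) <= del / 8.
  have : etab <= del / (16 * (D / s) ^+ 2) by rewrite ge_min lexx orbT.
  have Q0 : 0 < 16 * (D / s) ^+ 2 by rewrite mulr_gt0 // exprn_gt0.
  rewrite ler_pdivlMr // {Q0}.
  by move: ((D / s) ^+ 2) (etab) => Q E; lra.
pose om := del / (32 * d.+1%:R).
have om0 : 0 < om by rewrite divr_gt0 // mulr_gt0 // ltr0n.
have omE : 4 * (om * d%:R) <= del / 8.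
  have -> : del / 8 = 4 * (om * d.+1%:R).
    have : d.+1%:R != 0 :> R by rewrite pnatr_eq0.
    by rewrite /om; move: (d.+1%:R : R) => n n0; field.
  by rewrite ler_pM2l // ler_wpM2l ?(ltW om0) // ler_nat.
pose C := hj_const D s e; have C0 : 0 <= C := hj_const_ge0 e0 s0 (ltW D0).
pose C' := 2 * (D / s) * C + C ^+ 2.
have C'0 : 0 <= C' by rewrite addr_ge0 ?sqr_ge0 // mulr_ge0 // mulr_ge0 // ltW.
(* The first two bounds are required by [hj_increment], [r <= 1] allows [r ^+ 2] to be replaced by
   [r], and the last bound makes the remainder at most [om]. *)
pose r := Num.min D (Num.min (s * e / (3 * D)) (Num.min 1 (om / (C' + 1)))).
have C'1 : 0 < C' + 1 by lra.
have r0 : 0 < r by rewrite !lt_min D0 ltr01 !divr_gt0 // mulr_gt0.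
have rD : r <= D by rewrite ge_min lexx.
have rse : 3 * D * r <= s * e.
  have : r <= s * e / (3 * D) by rewrite ge_min; apply/orP; right; rewrite ge_min lexx.
  by rewrite ler_pdivlMr ?mulr_gt0 //; lra.
have r1 : r <= 1 by rewrite !ge_min lexx !orbT.
have rom : 2 * (D / s) * C * r + C ^+ 2 * r ^+ 2 <= om.
  have : r <= om / (C' + 1) by rewrite !ge_min lexx !orbT.
  rewrite ler_pdivlMr // => h1.
  have h2 : C ^+ 2 * r ^+ 2 <= C ^+ 2 * r.
    by rewrite ler_wpM2l ?sqr_ge0 // expr2 ler_piMl // ltW.
  by rewrite /C' in h1; lra.
have [eta [iso etaP]] := T_isotropic.
have [heta heta0 hetaP] := etaP _ etab0.
exists (Num.min heta (Num.min (r / 2) q)).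
  by rewrite !lt_min heta0 q0 divr_gt0.
move=> i; rewrite !le_min => /andP[/hetaP hi /andP[hir hiq]] m mC.
have etaK K : `|eta i K| <= etab.
  by apply: le_trans hi; exact: (le_bigmax _ (fun K => `|eta i K|) K).
have En0 : (0 <= curve_energy (theta i) m)%E.
  by apply: integral_ge0 => t _; exact: action_dual_ge0.
case EnE : (curve_energy (theta i) m) En0 => [En| |] // En0; last by rewrite leey.
rewrite lee_fin in En0; rewrite -EFinD.
(* The term [s * En] of the final estimate is small only for bounded [En]; larger energies are
   covered by the diameter bound. *)
have [DEn|EnD] := leP (D ^+ 2) En.
  apply: le_trans (W2_sqr_le_diam k0 D0 Omega_dist) _; rewrite lee_fin; lra.
pose slack := 2^-1 * (etab * (D / s) ^+ 2 + 2 * om * d%:R) + e * ln #|T0|%:R +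
  2 * (D / s * (h' + mesh_size (T i))).
have dual phi psi : (forall K L, psi L - phi K <= 2^-1 * enorm (pt T0 K - pt T0 L) ^+ 2) ->
    \sum_L psi L * discretize T0 mu1 L - \sum_K phi K * discretize T0 mu0 K <=
    (1 + s) * (En / 2 + slack).
  move=> feas.
  apply: le_trans (dual_le_hj D0 Omega_dist k0 s0 e0 (T i) mu0_Omega mu1_Omega feas) _.
  have mr : 2 * mesh_size (T i) <= r by lra.
  have := curve_energy_hj D0 Omega_dist k0 s0 e0 (fun K => phi K / (1 + s))
    (theta_mean i) (lambda_weight i) (theta_compatible i) (iso i) etaK etab1 mr rD rse rom mC.
  rewrite EnE lee_fin => en; rewrite ler_wpM2l ?addr_ge0 ?(ltW s0) //.
  by rewrite /slack -/h'; lra.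
apply: le_trans (W2_sqr_le_dual k0 Omega_dist dual) _; rewrite lee_fin -/h'.
have h'q' : D / s * h' <= D / s * q by rewrite ler_wpM2l ?(ltW Ds).
have hiq' : D / s * mesh_size (T i) <= D / s * q by rewrite ler_wpM2l ?(ltW Ds).
have slE : 4 * slack <= del / 8 + del / 8 + del / 8 + del / 8 + del / 8.
  move: etabE omE eN h'q' hiq' qE; rewrite /slack; move: (D / s) => X.
  by rewrite [X * (_ + _)]mulrDr; move: (X ^+ 2) => Y; lra.
have sEn : s * En <= s * D ^+ 2 by rewrite ler_wpM2l ?(ltW s0) ?(ltW EnD).
have sl0 : 0 <= slack.
  have h1 : 0 <= etab * (D / s) ^+ 2 by rewrite mulr_ge0 ?sqr_ge0 // ltW.
  have h2 : 0 <= om * d%:R by rewrite mulr_ge0 // ltW.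
  have h3 : 0 <= e * ln #|T0|%:R by rewrite mulr_ge0 // ltW.
  have h4 : 0 <= D / s * h' by rewrite mulr_ge0 // ltW.
  have h5 : 0 <= D / s * mesh_size (T i) by rewrite mulr_ge0 ?mesh_size_ge0 // ltW.
  by rewrite /slack mulrDr; lra.
have ssl : s * slack <= slack by rewrite ler_piMl.
have -> : 2 * ((1 + s) * (En / 2 + slack)) = En + s * En + 2 * slack + 2 * (s * slack).
  by field.
by move: sEn ssl slE h'D sD sl0; move: (s * En) (s * slack) (s * D ^+ 2) => X Y Z; lra.
Qed.

End Assembly.

Theorem theorem1p4 (R : realType) (d : nat) (d_gt0 : (0 < d)%N)
  (Omega : set 'rV[R]_d)
  (Omega_open : open Omega)
  (Omega_bounded : bounded_set Omega)
  (Omega_convex : convex_set (Omega : set (convex_lmodType 'rV[R]_d)))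
  (zeta : R) (zeta_itv : 0 < zeta <= 1)
  (mu0 mu1 : probability (borel R d) R)
  (mu0_Omega : mu0 (closure Omega) = 1%E)
  (mu1_Omega : mu1 (closure Omega) = 1%E)
  (I : Type) (T : I -> mesh Omega)
  (T_small : forall h : R, 0 < h -> exists i, mesh_size (T i) <= h)
  (T_regular : forall i, zeta_regular (T i) zeta)
  (lambda : forall i, T i -> T i -> R)
  (lambda_weight : forall i, weight_function (lambda i))
  (T_isotropic : asymptotically_isotropic T lambda)
  (theta : forall i, T i -> T i -> R -> R -> R)
  (theta_mean : forall i, mean_function (theta i))
  (theta_compatible : forall i, compatible (theta i) (lambda i)) :
  (W2 mu0 mu1 <=
   mesh_liminf T (fun i =>
     discrete_W (theta i) (discretize (T i) mu0) (discretize (T i) mu1)))%E.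
Proof.
set F := fun i => _.
have F0 i : (0 <= F i)%E.
  by apply: le_ereal_inf_tmp => _ [m _ <-]; exact: poweR_ge0.
have liminf_ge (a h : R) : 0 < h -> (forall i, mesh_size (T i) <= h -> (a%:E <= F i)%E) ->
    (a%:E <= mesh_liminf T F)%E.
  move=> h0 aF; apply: le_trans (ereal_sup_ubound _); last by exists h.
  by apply: le_ereal_inf_tmp => _ [i hi <-]; exact: aF.
have L0 : (0 <= mesh_liminf T F)%E by apply: (liminf_ge 0 1).
rewrite /W2 -/(W2_sqr mu0 mu1).
have [i0 _] := T_small 1 ltr01; have [k0 _] := mesh_inhabited (T i0) mu0_Omega.
have [D D0 Omega_dist] := bounded_dist Omega_bounded.
have cD := W2_sqr_le_diam mu0_Omega mu1_Omega k0 D0 Omega_dist.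
have c0 := @W2_sqr_ge0 R d mu0 mu1.
case cE : (W2_sqr mu0 mu1) c0 cD => [c| |] // c0 _; rewrite lee_fin in c0.
rewrite poweR_EFin powR12_sqrt //.
apply/lee_addgt0Pr => del del0.
(* The estimate on squares is used with error [del ^+ 2], because
   [sqrt c <= sqrt (c - del ^+ 2) + del]; for [c] below this error the claim follows from
   nonnegativity of the lower limit. *)
have [cdel|delc] := leP c (del ^+ 2).
  rewrite (@le_trans _ _ del%:E) ?leeDr // lee_fin -(ler_sqr (sqrtr_ge0 _)) ?nnegrE ?(ltW del0) //.
  by rewrite sqr_sqrtr.
have [h h0 hP] := W2_sqr_le_energy mu0_Omega mu1_Omega Omega_bounded T_small lambda_weight
  T_isotropic theta_mean theta_compatible (exprn_gt0 2 del0).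
have cd0 : 0 <= c - del ^+ 2 by rewrite subr_ge0 ltW.
apply: (@le_trans _ _ ((Num.sqrt (c - del ^+ 2))%:E + del%:E)%E).
  rewrite -EFinD lee_fin -ler_sqr ?nnegrE ?sqrtr_ge0 ?addr_ge0 ?sqrtr_ge0 ?(ltW del0) //.
  rewrite sqrrD !sqr_sqrtr // -mulr_natl.
  have : 0 <= Num.sqrt (c - del ^+ 2) * del by rewrite mulr_ge0 ?sqrtr_ge0 ?ltW.
  lra.
rewrite leeD2r //; apply: (liminf_ge _ h) => // i hi.
apply: le_ereal_inf_tmp => _ [m mC <-].
rewrite -powR12_sqrt // -poweR_EFin.
have := hP i hi m mC; rewrite cE -leeBlDr // -EFinB => le_en.
have cd0e : (0 <= (c - del ^+ 2)%:E)%E by rewrite lee_fin.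
by apply: gt0_ler_poweR; rewrite ?invr_ge0 ?in_itv /= ?leey ?cd0e ?(le_trans cd0e le_en).
Qed.
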